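(* Let $\Sigma$ be a finite alphabet, let $X,Y\subseteq\Sigma^{\mathbb{Z}}$ be constrained systems, and let $\mu$ be a shift-invariant ergodic Borel probability measure on $Y$. Then \[R_0(X,Y,\mu)=\inf\{\nu(\{\mathbf{x}_0\ne\mathbf{y}_0\}):\nu\in M_{\mathcal{E}}(X,Y,\mu)\}=\inf\{\nu(\{\mathbf{x}_0\ne\mathbf{y}_0\}):\nu\in M(X,Y,\mu)\},\] where $\{\mathbf{x}_0\ne\mathbf{y}_0\}=\{(\mathbf{x},\mathbf{y})\in X\times Y:\mathbf{x}_0\ne\mathbf{y}_0\}$.
   Context: A constrained system is a set $X\subseteq\Sigma^{\mathbb{Z}}$ for which there is a finite directed graph with edges labeled by $\Sigma$ such that $X$ is the set of label sequences of bi-infinite directed paths. $T$ is the left shift; on $X\times Y$ it acts diagonally. $M(X,Y,\mu)$ is the set of shift-invariant Borel probability measures $\nu$ on $X\times Y$ with $\nu(X\times A)=\mu(A)$ for all measurable $A\subseteq Y$; $M_{\mathcal{E}}(X,Y,\mu)$ is the subset of those ergodic for the shift on $X\times Y$. $\mathscr{B}_n(X)$ is the set of length-$n$ words appearing as consecutive subwords of elements of $X$; $d$ is Hamming distance, $B_r$ the Hamming ball. For $A,C\subseteq\Sigma^n$, a probability measure $\eta$ on $\Sigma^n$ and $\varepsilon>0$: $R_\varepsilon(C,A,\eta)=\min\{r\in\mathbb{Z}_{\ge0}:\eta(A\cap\bigcup_{\overline{x}\in C}B_r(\overline{x}))\ge1-\varepsilon\}$. With $\mu_n$ the marginal of $\mu$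 on coordinates $0,\dots,n-1$: $R_\varepsilon(X,Y,\mu)=\liminf_n\frac1nR_\varepsilon(\mathscr{B}_n(X),\mathscr{B}_n(Y),\mu_n)$, and the essential covering radius is $R_0(X,Y,\mu)=\lim_{\varepsilon\to0}R_\varepsilon(X,Y,\mu)$. *)

(* Defs.v *)
From HB Require Import structures.
From mathcomp Require Import all_boot all_order all_algebra.
From mathcomp Require Import all_classical all_reals all_analysis.
Set Implicit Arguments. Unset Strict Implicit. Unset Printing Implicit Defensive.
Import Order.TTheory GRing.Theory Num.Theory.
Local Open Scope classical_set_scope.
Local Open Scope ring_scope.

(* The full sh_shift Sigma^Z over a finite alphabet S.  The element a : S    *)
(* only witnesses that the alphabet is nonempty (needed for the pointed   *)
(* structure required by MathComp-Analysis' measurable types).           *)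
Definition fullshift (S : finType) (a : S) := int -> S.
HB.instance Definition _ (S : finType) (a : S) := gen_eqMixin (fullshift a).
HB.instance Definition _ (S : finType) (a : S) := gen_choiceMixin (fullshift a).
HB.instance Definition _ (S : finType) (a : S) :=
  isPointed.Build (fullshift a) (fun _ => a).

Notation word S n := {ffun 'I_n -> S}.

Definition cyl (S : finType) (a : S) (n : nat) (k : int) (w : word S n)
  : set (fullshift a) :=
  [set x | forall i : 'I_n, x (k + (i : nat)%:Z) = w i].
Arguments cyl {S} a {n} k w.

Definition cylinders (S : finType) (a : S) : set (set (fullshift a)) :=
  [set C | exists n (k : int) (w : word S n), C = cyl a k w].
Arguments cylinders {S} a.

(* Sigma^Z with its Borel sigma-algebra (product topology of discrete     *)
(* spaces), i.e. the sigma-algebra generated by the cylinder sets.        *)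
Definition shspace (S : finType) (a : S) := g_sigma_algebraType (cylinders a).
Arguments shspace {S} a.

Definition sh_shift (S : finType) (a : S) (x : shspace a) : shspace a :=
  fun i => x (i + 1).
Arguments sh_shift {S} a x.
Definition sh_shift2 (S : finType) (a : S) (xy : (shspace a * shspace a)%type)
  : (shspace a * shspace a)%type := (sh_shift a xy.1, sh_shift a xy.2).
Arguments sh_shift2 {S} a xy.

Definition constrained (S : finType) (X : set (int -> S)) : Prop :=
  exists (V E : finType) (src tgt : E -> V) (lab : E -> S),
    X = [set x | exists p : int -> E,
                 (forall i, tgt (p i) = src (p (i + 1))) /\
                 (forall i, x i = lab (p i))].

Definition sh_invariant (R : realType) (d : measure_display) (T : measurableType d)
  (f : T -> T) (P : probability T R) : Prop :=
  forall A : set T, measurable A -> P (f @^-1` A) = P A.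

Definition sh_ergodic (R : realType) (d : measure_display) (T : measurableType d)
  (f : T -> T) (P : probability T R) : Prop :=
  forall A : set T, measurable A -> f @^-1` A = A ->
    P A = 0%E \/ P A = 1%E.

Definition joining (R : realType) (S : finType) (a : S) (X Y : set (shspace a))
  (mu : probability (shspace a) R) (nu : probability ((shspace a * shspace a)%type) R)
  : Prop :=
  [/\ sh_invariant (sh_shift2 a) nu,
      nu (X `*` Y) = 1%E &
      forall A : set (shspace a), measurable A -> A `<=` Y ->
        nu (X `*` A) = mu A].

Definition ergodic_joining (R : realType) (S : finType) (a : S)
  (X Y : set (shspace a)) (mu : probability (shspace a) R)
  (nu : probability ((shspace a * shspace a)%type) R) : Prop :=
  joining X Y mu nu /\ sh_ergodic (sh_shift2 a) nu.

Definition diff0 (S : finType) (a : S) (X Y : set (shspace a))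
  : set ((shspace a * shspace a)%type) :=
  [set xy | X xy.1 /\ Y xy.2 /\ xy.1 0 <> xy.2 0].

Definition blocks (S : finType) (a : S) (X : set (shspace a)) (n : nat)
  : {set word S n} :=
  [set w : word S n | `[< exists x k, X x /\ forall i : 'I_n, x (k + (i : nat)%:Z) = w i >]].

Definition hamming (S : finType) (n : nat) (u v : word S n) : nat :=
  #|[set i | u i != v i]|.

(* R_eps(C, A, mu_n), where mu_n(w) = mu(cylinder of w at coordinates    *)
(* 0..n-1); the min is taken as an infimum in \bar R (= +oo if no r works) *)
Definition Reps_words (R : realType) (S : finType) (a : S)
  (mu : probability (shspace a) R) (n : nat) (C A : {set word S n}) (eps : R)
  : \bar R :=
  ereal_inf [set (r%:R)%:E | r in
    [set r : nat | ((1 - eps)%:E <=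
        \sum_(w in A | [exists c in C, (hamming w c <= r)%N]) mu (cyl a 0 w))%E]].

Definition Reps (R : realType) (S : finType) (a : S) (X Y : set (shspace a))
  (mu : probability (shspace a) R) (eps : R) : \bar R :=
  limn_einf (fun n : nat =>
    ((n%:R)^-1)%:E * Reps_words mu (blocks X n) (blocks Y n) eps)%E.

Definition R0 (R : realType) (S : finType) (a : S) (X Y : set (shspace a))
  (mu : probability (shspace a) R) : \bar R :=
  lim (Reps X Y mu e @[e --> 0^'+]).

(* Main.v *)
(* For an ergodic joining nu, the frequency of disagreements between x and y
   along an orbit is eventually at most nu(x_0 <> y_0) + o(1) outside a set of
   small measure, so that R_0 <= nu(x_0 <> y_0).
   Conversely, if R_0 < c, then for infinitely many n most y have a block of X
   within distance cn of y_0 ... y_(n-1).  Extending the nearest block to a point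
   of X gives a measure on pairs with second marginal mu; averaging it over the
   first n shifts and letting n grow along an ultrafilter gives a joining with
   nu(x_0 <> y_0) <= c.
   Finally, the infimum over joinings is attained by an ergodic one: minimize
   lexicographically nu(x_0 <> y_0) and then the values of nu on an enumeration
   of the clopen sets.  The minimizer is unique, hence extreme among joinings,
   and as mu is ergodic, conditioning a joining on an invariant set gives again
   a joining. *)

Require Import Defs.
From HB Require Import structures.
From mathcomp Require Import all_boot all_order all_algebra.
From mathcomp Require Import all_classical all_reals all_analysis measurable_realfun.
From mathcomp Require Import ring lra zify.
Import Order.TTheory GRing.Theory Num.Theory.
Import numFieldNormedType.Exports.
Local Open Scope classical_set_scope.
Local Open Scope ring_scope.
Set Implicit Arguments.
Unset Strict Implicit.
Unset Printing Implicit Defensive.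

(** * Frequency of visits under an ergodic transformation *)

Section ErgodicFrequency.
Context (R : realType) (d : measure_display) (T : measurableType d).
Implicit Types (P Q : probability T R) (f : T -> T) (C : set T) (c e : R).

Definition visits f C n (z : T) : R := \sum_(i < n) \1_C (iter i f z).

(* The maximal function max(0, S_1, ..., S_n) of the Birkhoff sums S_k of the
   function 1_C - c. *)
Fixpoint excess f C c n (z : T) : R :=
  if n is m.+1 then Num.max 0 (\1_C z - c + excess f C c m (f z)) else 0.

Lemma indic01 C (z : T) : 0 <= (\1_C z : R) <= 1.
Proof. by rewrite indicE; case: (_ \in _); rewrite lexx ler01. Qed.

Lemma visitsS f C n z : visits f C n.+1 z = \1_C z + visits f C n (f z).
Proof.
rewrite /visits big_ord_recl /=; congr (_ + _).
by apply: eq_bigr => i _; rewrite -iterSr.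
Qed.

Lemma excess_ge0 f C c n z : 0 <= excess f C c n z.
Proof. by case: n => //= n; rewrite le_max lexx. Qed.

Lemma excess_homo f C c z : {homo (fun n => excess f C c n z) : m n / (m <= n)%N >-> m <= n}.
Proof.
apply: homo_leq => //; first exact: le_trans.
move=> n; elim: n z => [|n IH] z /=; first by rewrite le_max lexx.
rewrite ge_max le_max lexx /= le_max; apply/orP; right.
by rewrite lerD2l; exact: IH.
Qed.

Lemma excess_le f C c n z : 0 <= c -> excess f C c n z <= n%:R.
Proof.
move=> c0; elim: n z => [|n IH] z //=; rewrite ge_max ler0n /=.
have /andP[_ h] := indic01 C z; have := IH (f z).
by rewrite -addn1 natrD; lra.
Qed.

(** The recursive branch of the maximum dominates the running sum, so [excess] bounds [visits] minus
    n c. *)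
Lemma visits_le_excess f C c n z : visits f C n z <= n%:R * c + excess f C c n z.
Proof.
elim: n z => [|n IH] z; first by rewrite /visits big_ord0 mul0r /= addr0.
rewrite visitsS /= -addn1 natrD.
have := IH (f z); set m := Num.max _ _ => h.
have : \1_C z - c + excess f C c n (f z) <= m by rewrite /m le_max lexx orbT.
lra.
Qed.

(** Pointwise form of the maximal inequality: where [excess] at [f z] is at least c, the recursive
    branch is nonnegative and equality holds; elsewhere the last indicator term supplies the missing
    c. *)
Lemma excess_step f C c n z : 0 <= c ->
  excess f C c n.+1 z + c <=
  excess f C c n (f z) + \1_C z + c * \1_[set x | excess f C c n (f x) < c] z.
Proof.
move=> c0 /=; have /andP[h0 h1] := indic01 C z.
have := excess_ge0 f C c n (f z); rewrite [\1_[set x | _] z]indicE => e0.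
rewrite -lerBrDr ge_max; have [h|h] := ltP (excess f C c n (f z)) c.
  by rewrite mem_set //= mulr1; apply/andP; split; lra.
rewrite memNset ?mulr0 ?addr0 /=; last by apply/negP; rewrite -leNgt.
by apply/andP; split; lra.
Qed.

Lemma iter_measurable f n : measurable_fun setT f -> measurable_fun setT (iter n f).
Proof.
move=> mf; elim: n => [|n IH] /=; first exact: measurable_id.
exact: measurableT_comp.
Qed.

Lemma measurable_excess f C c n : measurable_fun setT f -> measurable C ->
  measurable_fun setT (excess f C c n).
Proof.
move=> mf mC; elim: n => [|n IH] /=; first exact: measurable_cst.
apply: measurable_maxr; first exact: measurable_cst.
apply: measurable_funD; last exact: measurableT_comp.
by apply: measurable_funB => //; exact: measurable_indic.
Qed.

Lemma measurable_visits f C n : measurable_fun setT f -> measurable C ->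
  measurable_fun setT (visits f C n).
Proof.
move=> mf mC; apply: measurable_sum => i.
by apply: measurableT_comp (iter_measurable _ mf); exact: measurable_indic.
Qed.

Lemma measurable_set_lt (g h : T -> R) : measurable_fun setT g -> measurable_fun setT h ->
  measurable [set z | g z < h z].
Proof.
move=> mg mh; have := measurable_fun_ltr mg mh => /(_ measurableT [set true] I).
by rewrite setTI; congr (measurable _); apply/seteqP; split => z.
Qed.

Lemma invariant_integral P f (g : T -> \bar R) : measurable_fun setT f ->
  sh_invariant f P -> measurable_fun setT g -> (forall z, 0 <= g z)%E ->
  (\int[P]_z g (f z) = \int[P]_z g z)%E.
Proof.
move=> mf iP mg g0.
transitivity (\int[pushforward P f]_y g y)%E.
  by rewrite (ge0_integral_pushforward mf P).
by apply: eq_measure_integral => A mA _; exact: iP.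
Qed.

Lemma probability_integral_cst P (r : R) : (\int[P]_z r%:E = r%:E)%E.
Proof. by rewrite integral_cst //= probability_setT mule1. Qed.

Lemma noninc_mu0_small P (B : (set T)^nat) e : (forall n, measurable (B n)) ->
  nonincreasing_seq B -> P (\bigcap_n B n) = 0%E -> 0 < e ->
  exists N, forall n, (N <= n)%N -> (P (B n) <= e%:E)%E.
Proof.
move=> mB dB P0 e0.
have : P \o B @ \oo --> 0%E.
  rewrite -P0; apply: nonincreasing_cvg_mu => //.
    by rewrite (le_lt_trans (probability_le1 _ _)) ?ltry.
  exact: bigcapT_measurable.
move=> /fine_cvgP[_] /cvgrPdist_lt/(_ _ e0)[N _ hN]; exists N => n /hN /=.
rewrite sub0r normrN ger0_norm ?fine_ge0// => /ltW.
by rewrite -lee_fin fineK // fin_num_measure.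
Qed.

Lemma measurable_excess_lt f C c n : measurable_fun setT f -> measurable C ->
  measurable [set z | excess f C c n z < c].
Proof.
by move=> mf mC; apply: measurable_set_lt => //; exact: measurable_excess.
Qed.

(** Integrating [excess_step], invariance turns [excess] at [f z] into [excess] at z. Its integral
    is at most that of the next index and is finite, since [excess] at n is bounded by n, so it
    cancels. *)
Lemma excess_integral_step P f C c n : measurable_fun setT f -> sh_invariant f P ->
  measurable C -> 0 <= c ->
  (c%:E <= P C + c%:E * P [set z | (excess f C c n z < c)%R])%E.
Proof.
move=> mf iP mC c0.
set B := [set z | _]; have mB : measurable B by exact: measurable_excess_lt.
have mE k : measurable_fun setT (fun z => (excess f C c k z)%:E).
  by apply/measurable_EFinP; exact: measurable_excess.
have E0 k z : (0 <= (excess f C c k z)%:E)%E by rewrite lee_fin excess_ge0.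
pose I k := (\int[P]_z EFin (excess f C c k z))%E.
have Ifin k : I k \is a fin_num.
  rewrite ge0_fin_numE; last by apply: integral_ge0.
  apply: (@le_lt_trans _ _ (\int[P]_z (k%:R)%:E)%E).
    apply: ge0_le_integral => //.
    by move=> z _; rewrite lee_fin excess_le.
  by rewrite probability_integral_cst ltry.
have mf1B : measurable_fun setT (fun z => (\1_B (f z) : R)).
  by apply: measurableT_comp mf; exact: measurable_indic.
have h : (\int[P]_z ((excess f C c n.+1 z)%:E + c%:E) <=
   \int[P]_z ((excess f C c n (f z))%:E + ((\1_C z)%:E + (c%:E * (\1_B (f z))%:E))))%E.
  apply: ge0_le_integral => //.
  - by move=> z _; rewrite adde_ge0 // lee_fin.
  - by apply: emeasurable_funD.
  - apply: emeasurable_funD; first exact: (measurableT_comp (mE n) mf).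
    apply: emeasurable_funD; first by apply/measurable_EFinP; exact: measurable_indic.
    by apply: measurable_funeM; apply/measurable_EFinP.
  - move=> z _; rewrite -!EFinM -!EFinD lee_fin addrA.
    exact: excess_step.
move: h; rewrite ge0_integralD //; 
rewrite probability_integral_cst ge0_integralD //; first last.
- apply: emeasurable_funD; first by apply/measurable_EFinP; exact: measurable_indic.
  by apply: measurable_funeM; apply/measurable_EFinP.
- by move=> z _; rewrite -EFinM -EFinD lee_fin addr_ge0 ?mulr_ge0.
- exact: (measurableT_comp (mE n) mf).
rewrite (invariant_integral mf iP (mE n) (E0 n)) ge0_integralD //; first last.
- by apply: measurable_funeM; apply/measurable_EFinP.
- by move=> z _; rewrite -EFinM lee_fin mulr_ge0.
- by apply/measurable_EFinP; exact: measurable_indic.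
rewrite integral_indic // setIT ge0_integralZl_EFin //; first last.
- exact/measurable_EFinP.
rewrite (@invariant_integral P f (fun z => (\1_B z)%:E)) //; last first.
  by apply/measurable_EFinP; exact: measurable_indic.
rewrite integral_indic // setIT => h.
have : (I n + c%:E <= I n + (P C + c%:E * P B))%E.
  apply: le_trans h; rewrite leeD2r //; apply: ge0_le_integral => //.
  by move=> z _; rewrite lee_fin; exact: excess_homo.
by rewrite leeD2lE.
Qed.

(* If excess were unbounded almost surely, the correction term of
   excess_integral_step would vanish in the limit, leaving c <= P C. *)
Lemma excess_bounded_ae P f C c : measurable_fun setT f -> sh_invariant f P ->
  sh_ergodic f P -> measurable C -> (P C < c%:E)%E ->
  P [set z | forall N : nat, exists n, N%:R < excess f C c n z] = 0%E.
Proof.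
move=> mf iP eP mC PCc; set A := [set z | _].
have c0 : 0 < c by rewrite -lte_fin (le_lt_trans _ PCc).
have mA : measurable A.
  rewrite (_ : A = \bigcap_N \bigcup_n [set z | N%:R < excess f C c n z]).
    apply: bigcapT_measurable => N; apply: bigcupT_measurable => n.
    by apply: measurable_set_lt => //; exact: measurable_excess.
  apply/seteqP; split => z h N; first by move=> _; have [n hn] := h N; exists n.
  by have [n _ hn] := h N I; exists n.
(* From [f z] to z the excess drops by at most c, from z to [f z] by at most 1, up to one step in
   the index; the raised thresholds absorb both. *)
have iA : f @^-1` A = A.
  apply/seteqP; split => z h N.
    have [n hn] := h (N + (Num.truncn c).+1)%N; exists n.+1 => /=.
    rewrite lt_max; apply/orP; right; rewrite natrD in hn.
    have /andP[h0 _] := indic01 C z; have := truncnS_gt c; lra.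
  have [[|n] /=] := h N.+1; first by rewrite ltrn0.
  rewrite lt_max ltrn0 /= => hn; exists n; rewrite -addn1 natrD in hn.
  have /andP[_ h1] := indic01 C z; lra.
have [//|PA1] := eP A mA iA.
pose B n := [set z | excess f C c n z < c].
have PB0 : P (\bigcap_n B n) = 0%E.
  apply/eqP; rewrite eq_le measure_ge0 andbT.
  have <- : P (~` A) = 0%E by rewrite probability_setC // PA1 subee.
  apply: le_measure; rewrite ?inE.
  - by apply: bigcapT_measurable => n; exact: measurable_excess_lt.
  - exact: measurableC.
  - move=> z h zA; have [n hn] := zA (Num.truncn c).+1.
    have := h n I; rewrite /B /= => hc; have := truncnS_gt c; lra.
have PCfin : P C \is a fin_num by exact: fin_num_measure.
(* The witness makes c e half the gap between [P C] and c, so an index with [P (B N)] at most e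
   contradicts [excess_integral_step]. *)
have [e e0 he] : exists2 e : R, 0 < e & fine (P C) + c * e < c.
  exists ((c - fine (P C)) / (2 * c)).
    by rewrite divr_gt0 ?mulr_gt0// subr_gt0 -lte_fin fineK.
  have := PCc; rewrite -(fineK PCfin) lte_fin => h.
  rewrite (_ : c * _ = (c - fine (P C)) / 2); first lra.
  by field; rewrite gt_eqF.
have dB : nonincreasing_seq B.
  move=> m n mn; apply/subsetPset => z /=; apply: le_lt_trans.
  exact: excess_homo.
have [N hN] := noninc_mu0_small (fun n => measurable_excess_lt c n mf mC) dB PB0 e0.
have := excess_integral_step N mf iP mC (ltW c0).
have : (P (B N) <= e%:E)%E by exact: hN.
have : P (B N) \is a fin_num by apply: fin_num_measure; exact: measurable_excess_lt.
rewrite -/(B N); move: PCfin he.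
case: (P C) => // p _; case: (P (B N)) => // q /=; rewrite lee_fin => he _ qe.
rewrite -EFinM -EFinD lee_fin => h.
have cqe : c * q <= c * e by rewrite ler_pM2l.
have := le_lt_trans (le_trans h (lerD (lexx p) cqe)) he.
by rewrite ltxx.
Qed.

(** A one-sided ergodic theorem in probability. At the level c' halfway between [P C] and c the
    excess is almost surely bounded, hence at most N0 off a small set; more than n c visits would
    force an excess above n (c - c'), which passes N0 once n is large. *)
Lemma ergodic_visits P f C c e : measurable_fun setT f -> sh_invariant f P ->
  sh_ergodic f P -> measurable C -> (P C < c%:E)%E -> 0 < e ->
  exists N, forall n, (N <= n)%N ->
    (P [set z | (n%:R * c < visits f C n z)%R] <= e%:E)%E.
Proof.
move=> mf iP eP mC PCc e0.
have PCfin : P C \is a fin_num by exact: fin_num_measure.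
pose c' := (c + fine (P C)) / 2.
have := PCc; rewrite -(fineK PCfin) lte_fin => pc.
have PCc' : (P C < c'%:E)%E by rewrite -(fineK PCfin) lte_fin /c'; lra.
pose B N := \bigcup_n [set z | N%:R < excess f C c' n z].
have mB N : measurable (B N).
  apply: bigcupT_measurable => n.
  by apply: measurable_set_lt => //; exact: measurable_excess.
have dB : nonincreasing_seq B.
  move=> m n mn; apply/subsetPset => z /= [k _ /= hk]; exists k => //=.
  by apply: le_lt_trans hk; rewrite ler_nat.
have PB0 : P (\bigcap_N B N) = 0%E.
  rewrite -(excess_bounded_ae mf iP eP mC PCc'); congr (P _).
  apply/seteqP; split => z h N; first by have [n _ hn] := h N I; exists n.
  by move=> _; have [n hn] := h N; exists n.
have [N0 /(_ _ (leqnn _)) hN] := noninc_mu0_small mB dB PB0 e0.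
have d0 : 0 < c - c' by rewrite /c'; lra.
exists (Num.truncn (N0%:R / (c - c'))).+1 => n hn.
apply: le_trans hN; apply: le_measure; rewrite ?inE //.
  by apply: measurable_set_lt => //; exact: measurable_visits.
move=> z /= hz; exists n => //=.
have := visits_le_excess f C c' n z.
have : N0%:R < n%:R * (c - c').
  rewrite -ltr_pdivrMr //; apply: (lt_le_trans (truncnS_gt _)); by rewrite ler_nat.
rewrite mulrBr; lra.
Qed.

Lemma iter_invariant P f n : measurable_fun setT f -> sh_invariant f P ->
  sh_invariant (iter n f) P.
Proof.
move=> mf iP; elim: n => [|n IH] A mA //=.
rewrite -[RHS](IH A mA) -[RHS]iP.
  by congr (P _); apply/seteqP; split => z /=; rewrite -iterSr.
by rewrite -[X in measurable X]setTI; exact: iter_measurable.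
Qed.

Lemma visits_integral P f C n : measurable_fun setT f -> sh_invariant f P ->
  measurable C -> (\int[P]_z (visits f C n z)%:E = (n%:R)%:E * P C)%E.
Proof.
move=> mf iP mC.
transitivity (\int[P]_z (\sum_(i < n) (\1_C (iter i f z))%:E))%E.
  by apply: eq_integral => z _; rewrite sumEFin.
rewrite ge0_integral_sum //; last first.
  move=> i; apply/measurable_EFinP.
  by apply: measurableT_comp (iter_measurable _ mf); exact: measurable_indic.
rewrite (eq_bigr (fun=> P C)) => [|i _].
  rewrite -(fineK (fin_num_measure P C mC)) sumEFin sumr_const card_ord.
  by rewrite -EFinM mulr_natl.
have iPi := iter_invariant i mf iP.
rewrite (@invariant_integral P (iter i f) (fun z => (\1_C z)%:E)) //.
- by rewrite integral_indic // setIT.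
- exact: iter_measurable.
- by apply/measurable_EFinP; exact: measurable_indic.
Qed.

(* The frequency of visits to C has mean Q C under Q; by ergodicity it is at most
   P C + o(1) outside a P-small, hence Q-small, set. *)
Lemma ergodic_dominated_le P Q f (k : R) C : measurable_fun setT f -> sh_invariant f P ->
  sh_ergodic f P -> sh_invariant f Q ->
  (forall A, measurable A -> Q A <= k%:E * P A)%E -> measurable C ->
  (Q C <= P C)%E.
Proof.
move=> mf iP eP iQ QP mC.
have k0 : 0 <= k.
  have := QP _ measurableT; rewrite !probability_setT mule1 lee_fin; lra.
apply/lee_addgt0Pr => e e0.
have PCfin : P C \is a fin_num by exact: fin_num_measure.
(* Half of e raises the threshold above [P C]; the domination constant k turns P-mass at most e / (2
   (k + 1)) into Q-mass at most e / 2. *)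
pose c := fine (P C) + e / 2.
have PCc : (P C < c%:E)%E by rewrite -(fineK PCfin) lte_fin /c; lra.
have e'0 : 0 < e / (2 * (k + 1)) by rewrite divr_gt0 // mulr_gt0 //; lra.
have [N hN] := ergodic_visits mf iP eP mC PCc e'0.
(* A positive index is taken so that the final inequality can be divided by it. *)
have {hN} := hN N.+1 (leqnSn _); set B := [set z | _] => hB.
have mB : measurable B by apply: measurable_set_lt => //; exact: measurable_visits.
have c0 : 0 <= c by rewrite /c addr_ge0 ?fine_ge0 // ltW // divr_gt0.
have : (\int[Q]_z (visits f C N.+1 z)%:E <=
  \int[Q]_z ((N.+1%:R * c)%:E + (N.+1%:R)%:E * (\1_B z)%:E))%E.
  apply: ge0_le_integral => //.
  - by move=> z _; rewrite lee_fin sumr_ge0.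
  - by apply/measurable_EFinP; exact: measurable_visits.
  - apply: emeasurable_funD; first exact: measurable_cst.
    by apply: measurable_funeM; apply/measurable_EFinP; exact: measurable_indic.
  - move=> z _; rewrite -EFinM -EFinD lee_fin indicE.
    have [zB|zB] := pselect (B z).
      rewrite mem_set // mulr1 (@le_trans _ _ N.+1%:R) ?lerDr ?mulr_ge0 //.
      rewrite /visits -[N.+1 in leRHS]card_ord -sum1_card natr_sum ler_sum //.
      by move=> i _; have /andP[] := indic01 C (iter i f z).
    by rewrite memNset // mulr0 addr0 leNgt; apply/negP.
rewrite visits_integral // ge0_integralD //; first last.
- by apply: measurable_funeM; apply/measurable_EFinP; exact: measurable_indic.
- by move=> z _; rewrite lee_fin mulr_ge0.
rewrite probability_integral_cst.
rewrite ge0_integralZl_EFin //; last by apply/measurable_EFinP; exact: measurable_indic.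
rewrite integral_indic // setIT EFinM -muleDr //; last first.
rewrite lee_pmul2l // ?lte_fin ?ltr0n // => h.
apply: (le_trans h); rewrite -(fineK PCfin) -EFinD.
have QBe : (Q B <= (e / 2)%:E)%E.
  apply: (le_trans (QP B mB)).
  apply: (@le_trans _ _ (k%:E * (e / (2 * (k + 1)))%:E)%E).
    by apply: lee_pmul => //; rewrite lee_fin.
  rewrite -EFinM lee_fin; have k1 : 0 < 2 * (k + 1) by lra.
  rewrite mulrA ler_pdivrMr // (_ : e / 2 * (2 * (k + 1)) = e * k + e); last by field.
  by rewrite mulrC lerDl ltW.
apply: le_trans (leeD2l _ QBe) _.
by rewrite -EFinD lee_fin /c -addrA -splitr.
Qed.

Lemma ergodic_dominated_eq P Q f (k : R) C : measurable_fun setT f -> sh_invariant f P ->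
  sh_ergodic f P -> sh_invariant f Q ->
  (forall A, measurable A -> Q A <= k%:E * P A)%E -> measurable C -> Q C = P C.
Proof.
move=> mf iP eP iQ QP mC; apply/eqP; rewrite eq_le.
rewrite (ergodic_dominated_le mf iP eP iQ QP mC) /=.
have := ergodic_dominated_le mf iP eP iQ QP (measurableC mC).
rewrite !probability_setC //.
have : P C \is a fin_num by exact: fin_num_measure.
have : Q C \is a fin_num by exact: fin_num_measure.
case: (P C) => // p; case: (Q C) => // q _ _; rewrite -!EFinB !lee_fin; lra.
Qed.

End ErgodicFrequency.

(** * Clopen sets and extension of finitely additive contents *)

Section ClopenSets.
Context (F : finType) (T : Type) (coord : int -> T -> F).
Implicit Types C : set T.

(* Sets depending on finitely many coordinates; with a finite alphabet these are
   the clopen sets of the product topology. *)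
Definition clopen : set (set T) := [set C | exists N : nat, forall z z',
  (forall i : int, (`|i| <= N)%N -> coord i z = coord i z') -> C z -> C z'].

Lemma clopenT : clopen setT.
Proof. by exists 0%N. Qed.

Lemma clopen0 : clopen set0.
Proof. by exists 0%N. Qed.

Lemma clopenC C : clopen C -> clopen (~` C).
Proof.
move=> [N hN]; exists N => z z' zz' nCz Cz'; apply: nCz.
by apply: hN Cz' => i iN; rewrite zz'.
Qed.

Lemma clopenI C C' : clopen C -> clopen C' -> clopen (C `&` C').
Proof.
move=> [N hN] [N' hN']; exists (maxn N N') => z z' zz' [Cz C'z]; split.
  by apply: hN Cz => i iN; apply: zz'; rewrite leq_max iN.
by apply: hN' C'z => i iN; apply: zz'; rewrite leq_max iN orbT.
Qed.

Lemma clopenU C C' : clopen C -> clopen C' -> clopen (C `|` C').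
Proof.
move=> /clopenC h /clopenC h'; rewrite -[_ `|` _]setCK setCU.
exact/clopenC/clopenI.
Qed.

Lemma clopenD C C' : clopen C -> clopen C' -> clopen (C `\` C').
Proof. by move=> h /clopenC; exact: clopenI. Qed.

Lemma clopen_bigcap (J : finType) (G : J -> set T) :
  (forall j, clopen (G j)) -> clopen [set z | forall j, G j z].
Proof.
move=> /choice[N hN]; exists (\max_j N j) => z z' zz' h j.
by apply: hN (h j) => i iN; apply: zz'; rewrite (leq_trans iN) // leq_bigmax.
Qed.

Lemma clopen_coord (i : int) (p : set F) : clopen [set z | p (coord i z)].
Proof. by exists `|i|%N => z z' /(_ i (leqnn _)) /= ->. Qed.

Definition window N z : {ffun 'I_N.*2.+1 -> F} :=
  [ffun i : 'I_N.*2.+1 => coord ((i : nat)%:Z - N%:Z) z].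

Lemma eq_window N z z' : window N z = window N z' ->
  forall i : int, (`|i| <= N)%N -> coord i z = coord i z'.
Proof.
move=> h i iN; have ilt : (`|(i + N%:Z)%R|%N < N.*2.+1)%N by lia.
by have := congr1 (fun w => fun_of_fin w (Ordinal ilt)) h; rewrite !ffunE /=;
  rewrite (_ : _ - _ = i) //; lia.
Qed.

(** Pairs of a radius and a set of windows are countable, so [unpickle] lists them; codes that
    decode to nothing yield the empty set. A countable list is what makes lexicographic minimization
    over all clopen sets possible. *)
Definition clopen_enum (k : nat) : set T :=
  if unpickle k : option {N : nat & {set {ffun 'I_N.*2.+1 -> F}}} is Some u
  then [set z | window (tag u) z \in tagged u] else set0.

Lemma clopen_enumP k : clopen (clopen_enum k).
Proof.
rewrite /clopen_enum; case: unpickle => [[N W]|]; last exact: clopen0.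
exists N => z z' zz' /=; rewrite (_ : window N z' = window N z) //.
by apply/ffunP => i; rewrite !ffunE zz' //; have := ltn_ord i; lia.
Qed.

Lemma clopen_enum_surj C : clopen C -> exists k, clopen_enum k = C.
Proof.
move=> [N hN]; pose W := [set w | `[< exists2 z, C z & window N z = w >]]%SET.
exists (pickle (Tagged (fun N => {set {ffun 'I_N.*2.+1 -> F}}) W)).
rewrite /clopen_enum pickleK /=; apply/seteqP; split => z /=; rewrite inE.
  by move=> /asboolP[z' Cz' /eq_window zz']; exact: hN Cz'.
by move=> Cz; apply/asboolP; exists z.
Qed.

End ClopenSets.

Lemma clopen_measurable (F : finType) d (T : measurableType d) (coord : int -> T -> F) :
  (forall i s, measurable (coord i @^-1` [set s])) ->
  forall C, clopen coord C -> measurable C.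
Proof.
move=> mc C /clopen_enum_surj[k <-]; rewrite /clopen_enum.
case: unpickle => [[N W]|]; last exact: measurable0.
rewrite (_ : [set _ | _] = \bigcup_(w in [set w | w \in W])
    \bigcap_(i in [set: 'I_N.*2.+1]) coord ((i : nat)%:Z - N%:Z) @^-1` [set w i]).
  apply: fin_bigcup_measurable => // w _.
  by apply: fin_bigcap_measurable => // i _.
apply/seteqP; split => z /= => [hz|[w wW hw]].
  by exists (window coord N z) => // i _; rewrite /= ffunE.
by rewrite (_ : window _ _ _ = w) //; apply/ffunP => i; rewrite ffunE; exact: hw.
Qed.

(** * Convergence along ultrafilters *)

Section Ultrafilter.
Context (U : set_system nat) (UU : UltraFilter U).

Lemma ultra_fin (F : finType) (s : nat -> F) : exists f, U [set n | s n = f].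
Proof.
apply: contrapT => /forallNP h.
have : \forall n \near U, forall f, s n <> f.
  by apply: filter_forall => f; have [/h|] := in_ultra_setVsetC [set n | s n = f] UU.
by move=> /filter_ex[n /(_ (s n))].
Qed.

Lemma ultra_cvg (R : realType) (u : nat -> R) :
  (forall n, 0 <= u n <= 1) -> cvg (u @ U).
Proof.
move=> hu; have : compact `[0, 1 : R]%classic by exact: segment_compact.
rewrite compact_ultra => /(_ (u @ U)) [].
- split=> [|G PG uG]; first exact: fmap_proper_filter.
  apply/seteqP; split => // A GA.
  have [//|nA] := in_ultra_setVsetC (u @^-1` A) UU.
  have /filter_ex[x [Ax /(_ Ax)]] : G (A `&` ~` A) by apply: filterI => //; exact: uG.
  by [].
- suff h : u @^-1` `[0, 1] = setT by rewrite /fmap /= h; exact: filterT.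
  by apply/seteqP; split => // n _; rewrite /= in_itv /=; exact: hu.
by move=> l [_ ul]; apply/cvg_ex; exists l.
Qed.

End Ultrafilter.

Section ContentExtension.
Context (R : realType) (F : finType).

(** A copy of T tagged by [coord]: the algebra of clopen sets can be attached to it without
    disturbing any measurable structure of T. *)
Definition clopen_space (T : pointedType) (coord : int -> T -> F) : Type := T.

Section Instance.
Variables (T : pointedType) (coord : int -> T -> F).
HB.instance Definition _ := Pointed.on (clopen_space coord).
Definition clopen_display : measure_display. Proof. exact: default_measure_display. Qed.
HB.instance Definition _ := @isAlgebraOfSets.Build clopen_display (clopen_space coord)
  (clopen coord) (clopen0 coord) (@clopenU _ _ coord) (@clopenC _ _ coord).
End Instance.

Section Compactness.
Context (T : Type) (coord : int -> T -> F).
Hypothesis coord_surj : forall x : int -> F, exists z, forall i, coord i z = x i.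

(* A limit along an ultrafilter of points z_n of G n lies in every G n. *)
Lemma clopen_compact (G : (set T)^nat) : (forall n, clopen coord (G n)) ->
  nonincreasing_seq G -> \bigcap_n G n = set0 -> exists n, G n = set0.
Proof.
move=> cG dG G0; apply: contrapT => /forallNP hG.
have /choice[z zG] : forall n, exists z, G n z.
  by move=> n; have /eqP/set0P := hG n.
have [U [UU Uoo]] := ultraFilterLemma eventually_filter.
have /choice[x hx] i : exists s, U [set n | coord i (z n) = s].
  exact: (ultra_fin UU (fun n => coord i (z n))).
have [t ht] := coord_surj x.
suff : (\bigcap_n G n) t by rewrite G0.
move=> m _; have [N hN] := cG m.
have : \forall n \near U, forall i : 'I_N.*2.+1,
    coord ((i : nat)%:Z - N%:Z) (z n) = coord ((i : nat)%:Z - N%:Z) t.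
  by apply: filter_forall => i; rewrite ht; exact: hx.
have mU : U [set n | (m <= n)%N] by apply: Uoo; exact: nbhs_infty_ge.
move=> /(filterI mU)/filter_ex[n [mn hn]].
apply: (hN (z n)).
  apply: eq_window; apply/ffunP => i; rewrite !ffunE; exact: hn.
by have /subsetPset := dG _ _ mn; apply.
Qed.

End Compactness.

Context d (T : measurableType d) (coord : int -> T -> F).
Hypothesis coord_surj : forall x : int -> F, exists z, forall i, coord i z = x i.
Hypothesis measurable_clopen : @measurable d T `<=` <<s clopen coord >>.
Variable p : set T -> R.
Hypothesis p0 : forall C, clopen coord C -> 0 <= p C.
Hypothesis p1 : p setT = 1.
Hypothesis pU : forall C C', clopen coord C -> clopen coord C' -> C `&` C' = set0 ->
  p (C `|` C') = p C + p C'.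

Let T' := clopen_space coord.

Definition clopen_content (C : set T') : \bar R :=
  if `[< clopen coord C >] then (p C)%:E else 0%E.

Lemma clopen_contentE C : clopen coord C -> clopen_content C = (p C)%:E.
Proof. by move=> /asboolP h; rewrite /clopen_content h. Qed.

Lemma clopen_content0 : clopen_content set0 = 0%E.
Proof.
rewrite clopen_contentE; last exact: clopen0.
have := pU (clopen0 coord) (clopen0 coord) (setI0 _); rewrite setU0 => h.
by congr EFin; lra.
Qed.

Lemma clopen_content_ge0 C : (0 <= clopen_content C)%E.
Proof. by rewrite /clopen_content; case: asboolP => // /p0; rewrite lee_fin. Qed.

Lemma clopen_bigsetU (G : (set T)^nat) n : (forall i, clopen coord (G i)) ->
  clopen coord (\big[setU/set0]_(i < n) G i).
Proof.
move=> cG; elim: n => [|n IH]; first by rewrite big_ord0; exact: clopen0.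
by rewrite big_ord_recr /=; exact: clopenU.
Qed.

Lemma clopen_content_sum (G : (set T)^nat) n : (forall i, clopen coord (G i)) ->
  trivIset setT G ->
  (\sum_(0 <= i < n) clopen_content (G i) = clopen_content (\big[setU/set0]_(i < n) G i))%E.
Proof.
move=> cG tG; elim: n => [|n IH]; first by rewrite big_nil big_ord0 clopen_content0.
have cB := clopen_bigsetU n cG; have cB' := clopenU cB (cG n).
rewrite big_nat_recr //= IH big_ord_recr /= !clopen_contentE //.
rewrite -EFinD pU //.
rewrite -bigcup_mkord; apply/seteqP; split => // z [[i /= ilt Giz] Gnz].
have := @trivIsetP _ _ setT G; move=> [/(_ tG i n I I)]; rewrite ltn_eqF // => /(_ isT) h _.
by have : (G i `&` G n) z by []; rewrite h.
Qed.

(** If a clopen set is a disjoint union of clopen sets, the remainders [D n] are clopen and decrease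
    to the empty set, so compactness empties one of them: finitely many pieces exhaust the union and
    finite additivity suffices. *)
Lemma clopen_content_sigma_additive : semi_sigma_additive clopen_content.
Proof.
move=> G cG tG cUG.
pose D n := (\bigcup_i G i) `\` \big[setU/set0]_(i < n) G i.
have [n Dn] : exists n, D n = set0.
  apply: (clopen_compact coord_surj).
  - by move=> n; apply: clopenD => //; exact: clopen_bigsetU.
  - move=> m n mn; apply/subsetPset; apply: setDS.
    by apply: subset_bigsetU.
  - apply/seteqP; split => // z h; have [[k _ Gkz] _] := h 0%N I.
    have [_] := h k.+1 I; apply; rewrite -bigcup_mkord; exists k => //=.
apply: cvg_near_cst; exists n => // m /= nm.
rewrite clopen_content_sum //; congr clopen_content; apply/seteqP; split.
  by rewrite -bigcup_mkord => z [k _ Gkz]; exists k.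
move=> z hz; apply: contrapT => nz.
suff : D n z by rewrite Dn.
split => // h; apply: nz; exact: (subset_bigsetU nm).
Qed.

HB.instance Definition _ := isMeasure.Build _ _ _ clopen_content
  clopen_content0 clopen_content_ge0 clopen_content_sigma_additive.

Lemma content_extension :
  exists P : probability T R, forall C, clopen coord C -> P C = (p C)%:E.
Proof.
pose m := measure_extension clopen_content.
(* The Caratheodory extension lives on the sigma-algebra generated by the clopen sets; pushing
   forward along the identity restricts it to the measurable sets of T. *)
pose id' : g_sigma_algebraType (@measurable _ T') -> T := id.
have mid : measurable_fun setT id'.
  by move=> _ A mA; rewrite setTI; exact: measurable_clopen.
have mE C : clopen coord C -> m C = (p C)%:E.
  by move=> cC; rewrite -clopen_contentE //; exact: measurable_mu_extE.
pose Q0 : {measure set T -> \bar R} := pushforward m id'.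
pose Q := Q0 mid.
have Q1 : Q setT = 1%E by rewrite -p1; exact: (mE _ (clopenT coord)).
pose mixin := Measure_isProbability.Build _ _ _ Q Q1.
pose P : probability T R := HB.pack (Measure.sort Q) mixin.
exists P => C cC; exact: mE.
Qed.

End ContentExtension.

(** * Uniqueness, conditioning and limits of probability measures *)

Section ProbabilityTools.
Context (R : realType).

Lemma probability_clopen_unique (F : finType) d (T : measurableType d)
    (coord : int -> T -> F) (P Q : probability T R) :
  @measurable d T = <<s clopen coord >> ->
  (forall C, clopen coord C -> P C = Q C) ->
  forall A, measurable A -> P A = Q A.
Proof.
move=> mE PQ A mA.
apply: (measure_unique (clopen coord) (fun=> setT)) => //.
- exact: clopenI.
- by move=> _; exact: clopenT.
- by apply/seteqP; split => // z _; exists 0%N.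
- by move=> _; exact: le_lt_trans (probability_le1 P measurableT) (ltry _).
Qed.

Lemma probability_setI1 d (T : measurableType d) (P : probability T R) A B :
  measurable A -> measurable B -> P A = 1%E -> P (B `&` A) = P B.
Proof.
move=> mA mB PA1; apply/eqP; rewrite eq_le; apply/andP; split.
  by apply: le_measure; rewrite ?inE //; exact: measurableI.
have PA0 : P (~` A) = 0%E by rewrite probability_setC // PA1 subee.
rewrite -[in leLHS](setIT B) -(setvU A) setIUr.
apply: (le_trans (measureU2 _ _ _)); try exact: measurableI.
  by apply: measurableI => //; exact: measurableC.
rewrite [X in (X + _)%E](_ : _ = 0%E) ?add0e //.
apply/eqP; rewrite eq_le measure_ge0 andbT -PA0; apply: le_measure; rewrite ?inE //.
  by apply: measurableI => //; exact: measurableC.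
exact: measurableC.
Qed.

Lemma probability_pushforward d d' (T : measurableType d) (T' : measurableType d')
    (P : probability T R) (f : T -> T') : measurable_fun setT f ->
  exists Q : probability T' R, forall B, Q B = P (f @^-1` B).
Proof.
move=> mf.
pose Q0 : {measure set T' -> \bar R} := pushforward P f.
pose Q := Q0 mf.
have Q1 : Q setT = 1%E by exact: (probability_setT P).
pose mixin := Measure_isProbability.Build _ _ _ Q Q1.
pose Q' : probability T' R := HB.pack (Measure.sort Q) mixin.
by exists Q'.
Qed.

Lemma probability_cond d (T : measurableType d) (P : probability T R) (A : set T) :
  measurable A -> P A != 0%E ->
  exists Q : probability T R, forall B, (Q B * P A = P (B `&` A))%E.
Proof.
move=> mA PA0; pose m : {measure set T -> \bar R} := mrestr P mA.
exists (mnormalize m P) => B.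
have PAfin : P A \is a fin_num by exact: fin_num_measure.
have mT : m setT = P A by rewrite /m /= /mrestr setTI.
have PAoo : (P A == +oo%E) = false by move: PAfin; case: (P A).
have key : mnormalize m P B = (P (B `&` A) * (fine (P A))^-1%:E)%E.
  by rewrite /mnormalize mT (negbTE PA0) PAoo.
rewrite [X in (X * _)%E]key -muleA -{2}(fineK PAfin).
by rewrite -EFinM mulVf ?mule1 // fine_eq0.
Qed.

(** Weak compactness: setwise limits on clopen sets exist along U by boundedness, inherit finite
    additivity and extend to a measure. Each [q n] has to be additive on clopen sets only. *)
Lemma ultra_limit_probability (F : finType) d (T : measurableType d)
    (coord : int -> T -> F) (U : set_system nat) (UU : UltraFilter U)
    (q : nat -> set T -> R) :
  (forall x : int -> F, exists z, forall i, coord i z = x i) ->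
  @measurable d T = <<s clopen coord >> ->
  (forall n C, clopen coord C -> 0 <= q n C) -> (forall n, q n setT = 1) ->
  (forall n C C', clopen coord C -> clopen coord C' -> C `&` C' = set0 ->
    q n (C `|` C') = q n C + q n C') ->
  exists P : probability T R, forall C, clopen coord C ->
    q n C @[n --> U] --> fine (P C).
Proof.
move=> cs mE q0 q1 qU.
have cq C : clopen coord C -> cvg (q n C @[n --> U]).
  move=> cC; apply: ultra_cvg => n; rewrite q0 //= -(q1 n) -(setvU C) qU ?setICl //.
    by rewrite lerDr q0 //; exact: clopenC.
  exact: clopenC.
have [||||P hP] := @content_extension R F d T coord cs _ (fun C => lim (q n C @[n --> U])).
- by rewrite mE.
- move=> C cC /=; apply: limr_ge; [exact: cq | by apply: nearW => n; exact: q0].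
- by under eq_fun do rewrite q1; exact: lim_cst.
- move=> C C' cC cC' CC'; apply: cvg_lim => //.
  by under eq_fun do rewrite qU //; apply: cvgD; exact: cq.
by exists P => C cC; rewrite hP //; exact: cq.
Qed.

End ProbabilityTools.

(** * Clopen and Borel structure of the shift spaces *)

Section Shift.
Context (S : finType) (a : S).
Local Notation Z := (shspace a * shspace a)%type.

Definition coord1 (i : int) (x : shspace a) : S := x i.
Definition coord2 (i : int) (z : Z) : S * S := (z.1 i, z.2 i).

Lemma coord2_surj (x : int -> S * S) : exists z, forall i, coord2 i z = x i.
Proof.
by exists ((fun i => (x i).1), (fun i => (x i).2)) => i; rewrite /coord2 /=; case: (x i).
Qed.

Lemma measurable_coord1 i s : measurable (coord1 i @^-1` [set s]).
Proof.
apply: sub_sigma_algebra; exists 1%N, i, [ffun=> s]; apply/seteqP; split => x /=.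
  by move=> xs j; rewrite ffunE ord1 addr0.
by move=> /(_ ord0); rewrite ffunE addr0.
Qed.

Lemma cyl_clopen n (k : int) (w : word S n) : clopen coord1 (cyl a k w).
Proof.
rewrite (_ : cyl a k w = [set x | forall i : 'I_n, (coord1 (k + (i : nat)%:Z) x == w i)]).
  by apply: clopen_bigcap => i; exact: (clopen_coord coord1 _ (fun s => s == w i)).
by apply/seteqP; split => x h i; apply/eqP; exact: h.
Qed.

Lemma measurable_clopen1 (C : set (shspace a)) : clopen coord1 C -> measurable C.
Proof. by apply: clopen_measurable => i s; exact: measurable_coord1. Qed.

Lemma measurable_coord2 i (s : S * S) : measurable (coord2 i @^-1` [set s]).
Proof.
rewrite (_ : _ @^-1` _ = (coord1 i @^-1` [set s.1]) `*` (coord1 i @^-1` [set s.2])).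
  by apply: measurableX; exact: measurable_coord1.
apply/seteqP; split => -[x y] /=; rewrite /coord1 /coord2 /=; case: s => s t /=.
  by case=> -> ->.
by case=> -> ->.
Qed.

Lemma measurable_clopen2 (C : set Z) : clopen coord2 C -> measurable C.
Proof. by apply: clopen_measurable => i s; exact: measurable_coord2. Qed.

Lemma measurable1E : @measurable _ (shspace a) = <<s clopen coord1 >>.
Proof.
apply/seteqP; split; apply: smallest_sub => //.
- by move=> _ [n [k [w ->]]]; apply: sub_sigma_algebra; exact: cyl_clopen.
- exact: sigma_algebra_measurable.
- exact: measurable_clopen1.
Qed.

Lemma clopen_fst C : clopen coord1 C -> clopen coord2 (fst @^-1` C).
Proof. by move=> [N hN]; exists N => z z' zz'; apply: hN => i /zz'[]. Qed.

Lemma clopen_snd C : clopen coord1 C -> clopen coord2 (snd @^-1` C).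
Proof. by move=> [N hN]; exists N => z z' zz'; apply: hN => i /zz'[]. Qed.

Lemma measurable2E : @measurable _ Z = <<s clopen coord2 >>.
Proof.
apply/seteqP; split; apply: smallest_sub => //.
- rewrite subUset; split => _ [A mA <-].
    have h : measurable_fun setT (fst : g_sigma_algebraType (clopen coord2) -> shspace a).
      apply: (measurability (clopen coord1)); first exact: measurable1E.
      by move=> _ [C cC <-]; rewrite setTI; apply: sub_sigma_algebra; exact: clopen_fst.
    by rewrite setTI -[X in <<s _ >> X]setTI; exact: h.
  have h : measurable_fun setT (snd : g_sigma_algebraType (clopen coord2) -> shspace a).
    apply: (measurability (clopen coord1)); first exact: measurable1E.
    by move=> _ [C cC <-]; rewrite setTI; apply: sub_sigma_algebra; exact: clopen_snd.
  by rewrite setTI -[X in <<s _ >> X]setTI; exact: h.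
- exact: sigma_algebra_measurable.
- exact: measurable_clopen2.
Qed.

Lemma clopen_shift C : clopen coord1 C -> clopen coord1 (sh_shift a @^-1` C).
Proof.
move=> [N hN]; exists N.+1 => z z' zz'; apply: hN => i iN; apply: zz'; lia.
Qed.

Lemma clopen_shift2 C : clopen coord2 C -> clopen coord2 (sh_shift2 a @^-1` C).
Proof.
move=> [N hN]; exists N.+1 => z z' zz'; apply: hN => i iN; apply: (zz' (i + 1)); lia.
Qed.

Lemma measurable_sh_shift : measurable_fun setT (sh_shift a).
Proof.
apply: (measurability (clopen coord1)); first exact: measurable1E.
move=> _ [C cC <-]; rewrite setTI; apply: measurable_clopen1; exact: clopen_shift.
Qed.

Lemma measurable_sh_shift2 : measurable_fun setT (sh_shift2 a).
Proof.
apply: (measurability (clopen coord2)); first exact: measurable2E.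
move=> _ [C cC <-]; rewrite setTI; apply: measurable_clopen2; exact: clopen_shift2.
Qed.

Lemma iter_sh_shift n (x : shspace a) (i : int) : iter n (sh_shift a) x i = x (i + n%:Z).
Proof.
elim: n i => [|n IH] i /=; first by rewrite addr0.
by rewrite /sh_shift IH; congr (x _); lia.
Qed.

Lemma iter_sh_shift2 n (z : Z) :
  iter n (sh_shift2 a) z = (iter n (sh_shift a) z.1, iter n (sh_shift a) z.2).
Proof. by elim: n => [|n IH] /=; [case: z | rewrite IH]. Qed.

End Shift.

(** * Closedness of constrained systems *)

Section ConstrainedClosed.
Context (S : finType) (a : S) (X : set (shspace a)).
Hypothesis hX : constrained X.

Lemma constrained_shift x (k : int) : X x -> X (fun i => x (i + k)).
Proof.
case: hX => V [E [src [tgt [lab ->]]]] [p [hp xp]].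
exists (fun i => p (i + k)); split => i; last exact: xp.
by rewrite hp addrAC.
Qed.

Lemma constrained_iter_shift n x : X x -> X (iter n (sh_shift a) x).
Proof.
move=> /(constrained_shift n%:Z); congr X.
by apply/funext => i; rewrite iter_sh_shift.
Qed.

(** Clopen outer approximations of X. Limits of measures are controlled on clopen sets only, so full
    mass of X is tested on these. *)
Definition approx (m : nat) : set (shspace a) :=
  [set x | exists2 x', X x' & forall i : int, (`|i| <= m)%N -> x i = x' i].

Lemma clopen_approx m : clopen (@coord1 S a) (approx m).
Proof.
by exists m => z z' zz' [x' Xx' zx']; exists x' => // i im; rewrite -zx' //; exact/esym/zz'.
Qed.

(* Limit along an ultrafilter of the edge paths presenting the approximants of x. *)
Lemma constrained_closed x : (forall m, approx m x) -> X x.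
Proof.
case: hX => V [E [src [tgt [lab hE]]]]; rewrite /approx hE => hx.
have /choice[p hp] m : exists p : int -> E, (forall i, tgt (p i) = src (p (i + 1))) /\
    forall i : int, (`|i| <= m)%N -> x i = lab (p i).
  have [x' [p [pp xp]] xx'] := hx m.
  by exists p; split => // i im; rewrite xx'.
have [U [UU Uoo]] := ultraFilterLemma eventually_filter.
have /choice[q hq] i : exists s, U [set n | p n i = s].
  exact: (ultra_fin UU (fun n => p n i)).
exists q; split => i.
  have [n [h1 h2]] := filter_ex (filterI (hq i) (hq (i + 1))).
  by rewrite /= in h1 h2; rewrite -h1 -h2; exact: (hp n).1.
have iU : U [set n | (`|i| <= n)%N] by apply: Uoo; exact: nbhs_infty_ge.
have [n [h1 h2]] := filter_ex (filterI (hq i) iU).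
by rewrite /= in h1 h2; rewrite -h1; exact: (hp n).2.
Qed.

Lemma constrained_bigcap : X = \bigcap_m approx m.
Proof.
apply/seteqP; split => x; last by move=> h; apply: constrained_closed => m; exact: h.
by move=> Xx m _; exists x.
Qed.

Lemma constrained_measurable : measurable X.
Proof.
rewrite constrained_bigcap; apply: bigcapT_measurable => m.
exact: measurable_clopen1 (clopen_approx m).
Qed.

End ConstrainedClosed.

(** * Joinings and their limits *)

Section Joinings.
Context (R : realType) (S : finType) (a : S) (X Y : set (shspace a)).
Context (mu : probability (shspace a) R).
Local Notation Z := (shspace a * shspace a)%type.
Local Notation T2 := (sh_shift2 a).
Hypothesis hX : constrained X.
Hypothesis hY : constrained Y.
Hypothesis muY : mu Y = 1%E.

Let mX : measurable X := constrained_measurable hX.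
Let mY : measurable Y := constrained_measurable hY.

Lemma measurable_fst_pre (A : set (shspace a)) : measurable A ->
  measurable ((fst : Z -> _) @^-1` A).
Proof. by move=> mA; rewrite -[_ @^-1` _]setTI; exact: measurable_fst. Qed.

Lemma measurable_snd_pre (A : set (shspace a)) : measurable A ->
  measurable ((snd : Z -> _) @^-1` A).
Proof. by move=> mA; rewrite -[_ @^-1` _]setTI; exact: measurable_snd. Qed.

(** Both Y under [mu] and the product of X and Y under [nu] have full mass, so the restrictions to X
    and to subsets of Y reduce to ordinary marginal conditions, which suit limits and
    conditioning. *)
Lemma joiningP (nu : probability Z R) : joining X Y mu nu <->
  [/\ sh_invariant T2 nu, nu (fst @^-1` X) = 1%E &
      forall A, measurable A -> nu (snd @^-1` A) = mu A].
Proof.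
have XE (A : set (shspace a)) : X `*` A = snd @^-1` A `&` fst @^-1` X.
  by apply/seteqP; split => z [].
have mfX := measurable_fst_pre mX.
split => -[iN h1 h2]; split => //.
- apply/eqP; rewrite eq_le probability_le1 //= -h1; apply: le_measure; rewrite ?inE //.
    by apply: measurableX.
  by move=> z [].
- move=> A mA; rewrite -(probability_setI1 mY mA muY) -h2 ?subIsetr //; last exact: measurableI.
  rewrite -(probability_setI1 (measurableX mX mY) (measurable_snd_pre mA) h1).
  by congr (nu _); apply/seteqP; split => z /=; [move=> [Xz [Az Yz]] | move=> [Az [Xz Yz]]].
- by rewrite XE probability_setI1 // ?h2 //; exact: measurable_snd_pre.
- by move=> A mA _; rewrite XE probability_setI1 // ?h2 //; exact: measurable_snd_pre.
Qed.

(** Differs from [diff0] by dropping membership in X and Y, which makes it clopen, so that its mass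
    passes to limits. *)
Definition diff_set : set Z := [set z | z.1 0 != z.2 0].

Lemma clopen_diff : clopen (@coord2 S a) diff_set.
Proof. exact: (clopen_coord (@coord2 S a) 0 (fun s => s.1 != s.2)). Qed.

Lemma joining_diff0 (nu : probability Z R) : joining X Y mu nu ->
  nu (diff0 X Y) = nu diff_set.
Proof.
move=> [_ h1 _].
rewrite -(probability_setI1 (measurableX mX mY) (measurable_clopen2 clopen_diff) h1).
congr (nu _); apply/seteqP; split => z /=; rewrite /diff0 /diff_set /=.
  by move=> [Xz [Yz /eqP]].
by move=> [/eqP dz [Xz Yz]].
Qed.

Section Limits.
Context (U : set_system nat) (UU : UltraFilter U).

(** Asymptotic invariance of the set functions is enough: the limit is exactly invariant on clopen
    sets, hence on all measurable sets by uniqueness. The second marginal is settled the same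
    way. *)
Lemma limit_joining (q : nat -> set Z -> R) :
  (forall n C, clopen (@coord2 S a) C -> 0 <= q n C) -> (forall n, q n setT = 1) ->
  (forall n C C', clopen (@coord2 S a) C -> clopen (@coord2 S a) C' -> C `&` C' = set0 ->
    q n (C `|` C') = q n C + q n C') ->
  (forall C, clopen (@coord2 S a) C -> q n (T2 @^-1` C) - q n C @[n --> U] --> (0 : R)) ->
  (forall n m, q n (fst @^-1` approx X m) = 1) ->
  (forall n A, clopen (@coord1 S a) A -> q n (snd @^-1` A) = fine (mu A)) ->
  exists nu, joining X Y mu nu /\
    forall C, clopen (@coord2 S a) C -> q n C @[n --> U] --> fine (nu C).
Proof.
move=> q0 q1 qU qI qX qY.
have [nu hnu] := ultra_limit_probability UU (@coord2_surj S a) (@measurable2E S a) q0 q1 qU.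
exists nu; split => //; apply/joiningP.
have lim_eq C (l : R) : clopen (@coord2 S a) C -> q n C @[n --> U] --> l -> nu C = l%:E.
  move=> cC ql; rewrite -(fineK (fin_num_measure nu C (measurable_clopen2 cC))).
  by congr EFin; exact: (cvg_unique _ (hnu C cC) ql).
split.
- have [nu' hnu'] := probability_pushforward nu (@measurable_sh_shift2 S a).
  move=> A mA; rewrite -hnu'; apply: (probability_clopen_unique (@measurable2E S a)) mA => C cC.
  have cTC := clopen_shift2 cC.
  rewrite hnu' (lim_eq _ (fine (nu C)) cTC).
    by rewrite fineK // fin_num_measure //; exact: measurable_clopen2.
  have -> : (fun n => q n (T2 @^-1` C)) = (fun n => (q n (T2 @^-1` C) - q n C) + q n C).
    by apply/funext => n; rewrite subrK.
  rewrite -[fine _]add0r.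
  by apply: cvgD; [exact: qI | exact: hnu].
(* X is an intersection of clopen approximants, each of limit mass 1; their complements form a null
   union. *)
- rewrite (constrained_bigcap hX) preimage_bigcap.
  have m1 m : nu (fst @^-1` approx X m) = 1%E.
    apply: lim_eq; first exact: clopen_fst (clopen_approx X m).
    by under eq_fun do rewrite qX; exact: cvg_cst.
  have ma m : measurable ((fst : Z -> _) @^-1` approx X m).
    by apply: measurable_fst_pre; exact: measurable_clopen1 (clopen_approx X m).
  have m0 : nu (\bigcup_m ~` ((fst : Z -> _) @^-1` approx X m)) = 0%E.
    apply: measure_negligible; first by apply: bigcupT_measurable => m; exact: measurableC.
    apply: negligible_bigcup => m; apply/negligibleP; first exact: measurableC.
    have : nu (~` ((fst : Z -> _) @^-1` approx X m)) = 0%E.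
      by rewrite probability_setC // m1 subee.
    exact.
  rewrite -[X in nu X]setCK setC_bigcap probability_setC.
    by rewrite m0 sube0.
  by apply: bigcupT_measurable => m; exact: measurableC.
- have [nu' hnu'] := probability_pushforward nu (@measurable_snd _ _ (shspace a) (shspace a)).
  move=> A mA; rewrite -hnu'; apply: (probability_clopen_unique (@measurable1E S a)) mA => C cC.
  rewrite hnu' (lim_eq _ (fine (mu C)) (clopen_snd cC)).
    by rewrite fineK // fin_num_measure //; exact: measurable_clopen1.
  by under eq_fun do rewrite qY //; exact: cvg_cst.
Qed.

(** Compactness of the set of joinings, with convergence tested on clopen sets; here invariance and
    marginals are exact along the sequence. *)
Lemma joining_limit (nus : nat -> probability Z R) : (forall n, joining X Y mu (nus n)) ->
  exists nu, joining X Y mu nu /\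
    forall C, clopen (@coord2 S a) C -> fine (nus n C) @[n --> U] --> fine (nu C).
Proof.
move=> hn; have jn n := (joiningP (nus n)).1 (hn n).
apply: (@limit_joining (fun n C => fine (nus n C))).
- by move=> n C _; exact: fine_ge0.
- by move=> n; rewrite probability_setT.
- move=> n C C' /measurable_clopen2 mC /measurable_clopen2 mC' CC'.
  by rewrite measureU // fineD // fin_num_measure.
- move=> C cC.
  have -> : (fun n => fine (nus n (T2 @^-1` C)) - fine (nus n C)) = cst 0.
    apply/funext => n; have [iN _ _] := jn n.
    by rewrite iN ?subrr //; exact: measurable_clopen2.
  exact: cvg_cst.
- move=> n m; have [_ h _] := jn n.
  suff -> : nus n (fst @^-1` approx X m) = 1%E by [].
  apply/eqP; rewrite eq_le probability_le1 /=; last first.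
    by apply: measurable_fst_pre; exact: measurable_clopen1 (clopen_approx X m).
  rewrite -h; apply: le_measure; rewrite ?inE.
  - exact: measurable_fst_pre.
  - by apply: measurable_fst_pre; exact: measurable_clopen1 (clopen_approx X m).
  - by move=> z Xz; exists z.1.
- by move=> n A cA; have [_ _ ->] := jn n => //; exact: measurable_clopen1.
Qed.

End Limits.

End Joinings.

(** * An ergodic minimizer *)

Section LexicographicMinimizer.
Context (R : realType) (S : finType) (a : S) (X Y : set (shspace a)).
Context (mu : probability (shspace a) R).
Local Notation Z := (shspace a * shspace a)%type.
Local Notation T2 := (sh_shift2 a).
Hypothesis hX : constrained X.
Hypothesis hY : constrained Y.
Hypothesis muY : mu Y = 1%E.
Hypothesis mu_inv : sh_invariant (sh_shift a) mu.
Hypothesis mu_erg : sh_ergodic (sh_shift a) mu.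

(** The disagreement set comes first so that its mass is minimized before all others. *)
Definition lex_enum (k : nat) : set Z :=
  if k is k'.+1 then clopen_enum (@coord2 S a) k' else @diff_set S a.

Lemma clopen_lex_enum k : clopen (@coord2 S a) (lex_enum k).
Proof. by case: k => [|k]; [exact: clopen_diff | exact: clopen_enumP]. Qed.

(** Stage k + 1 keeps the survivors of stage k that minimize the k-th set; lying in all stages means
    being a lexicographic minimizer. *)
Fixpoint lex_min (k : nat) (nu : probability Z R) : Prop :=
  if k is k'.+1 then lex_min k' nu /\
    forall nu', lex_min k' nu' -> (nu (lex_enum k') <= nu' (lex_enum k'))%E
  else joining X Y mu nu.

Lemma lex_minW k j nu : (j <= k)%N -> lex_min k nu -> lex_min j nu.
Proof.
elim: k => [|k IH]; first by rewrite leqn0 => /eqP ->.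
by rewrite leq_eqVlt ltnS => /orP[/eqP -> //|jk] [/(IH jk)].
Qed.

Lemma fine_le_lex k (nu nu' : probability Z R) :
  (nu (lex_enum k) <= nu' (lex_enum k))%E = (fine (nu (lex_enum k)) <= fine (nu' (lex_enum k))).
Proof.
have mE := measurable_clopen2 (clopen_lex_enum k).
by rewrite -lee_fin !fineK // fin_num_measure.
Qed.

Section Limits.
Context (U : set_system nat) (UU : UltraFilter U) (Uoo : \oo `<=` U).

(** Minimality is a non-strict inequality between masses of a clopen set, so it survives the
    limit. *)
Lemma lex_min_closed k (nus : nat -> probability Z R) nu : joining X Y mu nu ->
  (forall C, clopen (@coord2 S a) C -> fine (nus n C) @[n --> U] --> fine (nu C)) ->
  (\forall n \near U, lex_min k (nus n)) -> lex_min k nu.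
Proof.
move=> jnu hnu; elim: k => [|k IH] //= hk; split.
  by apply: IH; apply: filterS hk => n [].
move=> nu' hnu'; rewrite fine_le_lex.
apply: (cvgr_to_le (hnu _ (clopen_lex_enum k))).
by apply: filterS hk => n [_ /(_ _ hnu')]; rewrite fine_le_lex.
Qed.

(** The limit of a minimizing sequence within stage k stays in stage k and attains the infimum. *)
Lemma lex_min_nonempty k : (exists nu, joining X Y mu nu) -> exists nu, lex_min k nu.
Proof.
move=> nu0; elim: k => [|k [nu1 hnu1]] //=.
pose A := [set fine (nu (lex_enum k)) | nu in lex_min k].
have hA : has_inf A.
  split; first by exists (fine (nu1 (lex_enum k))), nu1.
  by exists 0 => _ [nu _ <-]; exact: fine_ge0.
have /choice[nus hnus] (n : nat) : exists nu,
    lex_min k nu /\ fine (nu (lex_enum k)) < inf A + n.+1%:R^-1.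
  have n0 : 0 < n.+1%:R^-1 :> R by rewrite invr_gt0.
  by have [_ [nu hnu <-] ?] := inf_adherent n0 hA; exists nu.
have jn n : joining X Y mu (nus n) := lex_minW (leq0n k) (hnus n).1.
have [nu [jnu hnu]] := joining_limit hX hY muY UU jn.
exists nu; split.
  by apply: (lex_min_closed jnu hnu); apply: nearW => n; exact: (hnus n).1.
move=> nu' hnu'; rewrite fine_le_lex.
apply: (@le_trans _ _ (inf A)); last first.
  by apply: ge_inf; [exact: hA.2 | exists nu'].
apply/ler_addgt0Pr => e e0.
apply: (cvgr_to_le (hnu _ (clopen_lex_enum k))).
have : U [set n | n.+1%:R^-1 < e :> R].
  by apply: Uoo; have := near_infty_natSinv_lt (PosNum e0).
by apply: filterS => n /= ne; rewrite (le_trans (ltW (hnus n).2)) // lerD2l ltW.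
Qed.

End Limits.

(** Stages are nested, so a sequence whose n-th term lies in stage n is eventually in every stage,
    and its limit lies in all of them. *)
Lemma lex_min_all : (exists nu, joining X Y mu nu) -> exists nu, forall k, lex_min k nu.
Proof.
move=> nu0; have [U [UU Uoo]] := ultraFilterLemma eventually_filter.
have /choice[nus hnus] k := lex_min_nonempty UU Uoo k nu0.
have [|nu [jnu hnu]] := joining_limit hX hY muY UU (nus := nus).
  by move=> n; exact: (lex_minW (leq0n n) (hnus n)).
exists nu => k; apply: (lex_min_closed UU jnu hnu).
have kU : U [set n | (k <= n)%N] by apply: Uoo; exact: nbhs_infty_ge.
by apply: filterS kU => n kn; exact: lex_minW kn (hnus n).
Qed.

(** The delicate point is the second marginal: it is invariant and at most [mu] divided by [nu A],
    so ergodicity of [mu] forces it to be [mu]. *)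
Lemma joining_cond (nu : probability Z R) A : joining X Y mu nu ->
  measurable A -> T2 @^-1` A = A -> nu A != 0%E ->
  exists nuA, joining X Y mu nuA /\ forall B, (nuA B * nu A = nu (B `&` A))%E.
Proof.
move=> /(joiningP hX hY muY)[iN hNX hNY] mA iA nA0.
have [nuA hA] := probability_cond mA nA0; exists nuA; split => //.
have nAfin : nu A \is a fin_num by exact: fin_num_measure.
have canc x y : (x * nu A = y * nu A -> x = y)%E.
  move=> h; have := congr1 (fun t => t * (fine (nu A))^-1%:E)%E h.
  have nuAV : (nu A * (fine (nu A))^-1%:E = 1)%E.
    by rewrite -{1}(fineK nAfin) -EFinM divff // fine_eq0.
  by rewrite -!muleA nuAV !mule1.
have iNA : sh_invariant T2 nuA.
  move=> B mB; apply: canc; rewrite !hA -[in LHS]iA -preimage_setI iN //.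
  exact: measurableI.
apply/(joiningP hX hY muY); split => //.
- apply: canc; rewrite hA mul1e setIC probability_setI1 //.
  exact: measurable_fst_pre (constrained_measurable hX).
- have [Q hQ] := probability_pushforward nuA (@measurable_snd _ _ (shspace a) (shspace a)).
  move=> B mB; rewrite -hQ.
  apply: (@ergodic_dominated_eq _ _ _ mu Q (sh_shift a) (fine (nu A))^-1) => //.
  + exact: measurable_sh_shift.
  + move=> C mC; rewrite !hQ -[RHS]iNA //; exact: measurable_snd_pre.
  + move=> C mC; rewrite hQ -hNY // muleC -[leLHS]mule1.
    have -> : (1 = nu A * (fine (nu A))^-1%:E)%E.
      by rewrite -{1}(fineK nAfin) -EFinM divff // fine_eq0.
    rewrite muleA hA; apply: lee_wpmul2r.
      by rewrite lee_fin invr_ge0 fine_ge0.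
    have mC' := measurable_snd_pre mC.
    by apply: le_measure; rewrite ?inE //; exact: measurableI.
Qed.

(* nu is a convex combination of its conditionings on A and on ~` A, which are
   joinings; by minimality they agree with nu on every clopen set. *)
Lemma lex_min_ergodic nu : (forall k, lex_min k nu) -> sh_ergodic T2 nu.
Proof.
move=> hk A mA iA; have [->|nA0] := eqVneq (nu A) 0%E; first by left.
have [|nA1] := eqVneq (nu A) 1%E; [by right | exfalso].
have jnu : joining X Y mu nu := hk 0%N.
have nAfin : nu A \is a fin_num by exact: fin_num_measure.
have nCA0 : nu (~` A) != 0%E.
  apply: contra nA1 => /eqP h; have := probability_setC nu mA; rewrite h.
  move: nAfin; case: (nu A) => // t _ /eqP.
  by rewrite -EFinB !eqe eq_sym subr_eq0 eq_sym.
have [P [jP hP]] := joining_cond jnu mA iA nA0.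
have iCA : T2 @^-1` (~` A) = ~` A by rewrite -preimage_setC iA.
have [Q [jQ hQ]] := joining_cond jnu (measurableC mA) iCA nCA0.
(* Minimality makes the values of P and Q at least that of [nu], which is a strict convex
   combination of them; so all three agree. *)
have eqk k : lex_min k P /\ lex_min k Q ->
    P (lex_enum k) = nu (lex_enum k) /\ Q (lex_enum k) = nu (lex_enum k).
  move=> [kP kQ]; have mE := measurable_clopen2 (clopen_lex_enum k).
  have := (hk k.+1).2 _ kP; have := (hk k.+1).2 _ kQ; rewrite !fine_le_lex.
  set E := lex_enum k in mE *.
  have : (P E * nu A + Q E * nu (~` A) = nu E)%E.
    rewrite hP hQ -measureU; [by rewrite -setIUr setUv setIT| | |].
    - exact: measurableI.
    - by apply: measurableI => //; exact: measurableC.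
    - by rewrite setIACA setICr setI0.
  have A1 : (fine (nu A) < 1).
    move: nAfin nA1 (probability_le1 nu mA); case: (nu A) => // t _.
    by rewrite eqe lee_fin lt_neqAle => -> ->.
  have A0 : (0 < fine (nu A)).
    by rewrite lt_neqAle fine_ge0 // andbT eq_sym fine_eq0.
  have real_of (P' : probability Z R) B : measurable B -> P' B = (fine (P' B))%:E.
    by move=> mB; rewrite fineK // fin_num_measure.
  rewrite probability_setC // (real_of P _ mE) (real_of Q _ mE) (real_of nu _ mE).
  rewrite (real_of nu _ mA) /=.
  move: (fine (P E)) (fine (Q E)) (fine (nu E)) (fine (nu A)) A0 A1 => p q e t t0 t1.
  rewrite -EFinB -!EFinM -EFinD => -[<-] h1 h2.
  have h : p = q by nra.
  by rewrite h; split; congr EFin; ring.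
(* Agreement on the j-th set promotes P and Q to the next stage, which in turn makes the next
   agreement available. *)
have lexPQ j : lex_min j P /\ lex_min j Q.
  elim: j => [|j [jP' jQ']] //=; have [eP eQ] := eqk j (conj jP' jQ').
  rewrite eP eQ; split; split=> // nu' hnu'; exact: (hk j.+1).2.
(* P and [nu] agree on clopen sets, hence on A; but conditioning gives [P A * nu A = nu A], so
   [nu A] is 0 or 1. *)
have PE : P A = nu A.
  apply: (probability_clopen_unique (@measurable2E S a)) mA => C.
  by move=> /clopen_enum_surj[k <-]; exact: (eqk k.+1 (lexPQ _)).1.
have := hP A; rewrite setIid PE => /eqP.
rewrite -(fineK nAfin) -EFinM eqe -subr_eq0 -{3}[fine _]mulr1 -mulrBr mulf_eq0 subr_eq0.
by rewrite fine_eq0 // (negbTE nA0) /= -eqe fineK // (negbTE nA1).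
Qed.

Lemma ergodic_joining_minimizer : (exists nu, joining X Y mu nu) ->
  exists nu, ergodic_joining X Y mu nu /\
    forall nu', joining X Y mu nu' -> (nu (diff0 X Y) <= nu' (diff0 X Y))%E.
Proof.
move=> /lex_min_all[nu hk]; exists nu; split.
  by split; [exact: (hk 0%N) | exact: lex_min_ergodic].
move=> nu' jnu'; rewrite (joining_diff0 hX hY jnu') (joining_diff0 hX hY (hk 0%N)).
exact: (hk 1%N).2.
Qed.

End LexicographicMinimizer.

(** * The essential covering radius *)

Section LimInf.
Context (R : realType).
Local Open Scope ereal_scope.
Implicit Types u : (\bar R)^nat.

Lemma limn_einf_le_frequently u c :
  (forall N, exists2 n, (N <= n)%N & u n <= c) -> limn_einf u <= c.
Proof.
move=> h; rewrite limn_einf_lim; apply: lime_le; first exact: is_cvg_einfs.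
apply: nearW => N; have [n Nn un] := h N.
by apply: le_trans un; apply: ereal_inf_lbound; exists n.
Qed.

Lemma limn_einf_lt_frequently u c : limn_einf u < c ->
  forall N, exists2 n, (N <= n)%N & u n < c.
Proof.
move=> h N; have : einfs u N < c.
  apply: le_lt_trans h; rewrite limn_einf_lim.
  have -> : limn (einfs u) = ereal_sup (range (einfs u)).
    by apply: cvg_lim => //; exact: cvg_einfs_sup.
  by apply: ereal_sup_ubound; exists N.
by move=> /ereal_inf_lt[_ [n Nn <-]]; exists n.
Qed.

Lemma limn_einf_homo u v : (forall n, u n <= v n) -> limn_einf u <= limn_einf v.
Proof.
move=> uv; rewrite !limn_einf_lim; apply: lee_lim; [exact: is_cvg_einfs..|].
apply: nearW => N; apply: le_ereal_inf_tmp => _ [n Nn <-].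
by apply: le_trans (uv n); apply: ereal_inf_lbound; exists n.
Qed.

Lemma lee_ltP (x y : \bar R) : (forall c : R, x < c%:E -> y <= c%:E) -> y <= x.
Proof.
case: x => [x| |] h; last 2 first.
- by rewrite leey.
- case: y h => [y| |] //= h.
    by have := h (y - 1)%R (ltNyr _); rewrite lee_fin lerDl oppr_ge0 ler10.
  by have := h 0%R (ltNyr _).
by apply/lee_addgt0Pr => e e0; apply: h; rewrite lte_fin ltrDl.
Qed.

End LimInf.

(** * Events determined by a finitely valued map *)

Section FiniteFibers.
Context (R : realType) d (T : measurableType d) (P : probability T R).
Context (I : finType) (f : T -> I).
Hypothesis mf : forall i, measurable (f @^-1` [set i]).

Lemma measurable_fiber_pred (p : pred I) : measurable [set z | p (f z)].
Proof.
rewrite (_ : [set z | _] = \bigcup_(i in [set i | p i]) f @^-1` [set i]).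
  exact: fin_bigcup_measurable.
by apply/seteqP; split => z /= => [pz|[i pi ->] //]; exists (f z).
Qed.

Lemma sum_fibers (p : pred I) :
  (\sum_(i | p i) P (f @^-1` [set i]) = P [set z | p (f z)])%E.
Proof.
have key (s : seq I) : uniq s ->
    (\sum_(i <- s) P (f @^-1` [set i]) = P [set z | f z \in s])%E.
  elim: s => [_|i s IH /= /andP[si us]].
    by rewrite big_nil (_ : [set z | _] = set0) ?measure0 //; apply/seteqP; split.
  rewrite big_cons IH // -measureU //.
  - congr (P _); apply/seteqP; split => z /=; rewrite inE.
      by case=> [->|->]; rewrite ?eqxx ?orbT.
    by case/orP => [/eqP|]; [left|right].
  - exact: (measurable_fiber_pred (fun i => i \in s)).
  - by apply/seteqP; split => // z [/= ->]; rewrite (negbTE si).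
rewrite -big_filter key; last first.
  by rewrite filter_uniq // index_enum_uniq.
by congr (P _); apply/seteqP; split => z /=; rewrite mem_filter mem_index_enum andbT.
Qed.

End FiniteFibers.

(** * Covering of words and disagreement counts *)

Section CoveringRadius.
Context (R : realType) (S : finType) (a : S) (X Y : set (shspace a)).
Context (mu : probability (shspace a) R).
Local Notation Z := (shspace a * shspace a)%type.
Local Notation T2 := (sh_shift2 a).

Definition prefix_word n (y : shspace a) : word S n := [ffun i : 'I_n => y (i : nat)%:Z].

Lemma cyl_prefix_word n (w : word S n) : cyl a 0 w = prefix_word n @^-1` [set w].
Proof.
apply/seteqP; split => y /= => [h|<- i]; last by rewrite ffunE add0r.
by apply/ffunP => i; rewrite ffunE -h add0r.
Qed.

Lemma measurable_prefix_word n w : measurable (@prefix_word n @^-1` [set w]).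
Proof. by rewrite -cyl_prefix_word; apply: sub_sigma_algebra; exists n, 0, w. Qed.

Definition covered n r (w : word S n) : bool :=
  (w \in blocks Y n) && [exists c in blocks X n, (hamming w c <= r)%N].

(** Turns the sum over words in [Reps_words] into the mass of one event on points. *)
Lemma sum_covered n r :
  (\sum_(w in blocks Y n | [exists c in blocks X n, (hamming w c <= r)%N]) mu (cyl a 0 w) =
   mu [set y | covered r (prefix_word n y)])%E.
Proof.
rewrite -(sum_fibers mu (@measurable_prefix_word n) (covered r)).
by apply: eq_bigr => w _; rewrite cyl_prefix_word.
Qed.

Lemma Reps_homo e e' : e <= e' -> (Reps X Y mu e' <= Reps X Y mu e)%E.
Proof.
move=> ee'; apply: limn_einf_homo => n; apply: lee_wpmul2l; first by rewrite lee_fin.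
apply: ereal_inf_le_tmp => _ [r /= hr <-]; exists r => //=.
by apply: le_trans hr; rewrite lee_fin lerB.
Qed.

(** Monotonicity in the tolerance turns the right limit at 0 into a supremum; the bound 1 merely
    fixes a neighbourhood of 0. *)
Lemma R0E : R0 X Y mu = ereal_sup [set Reps X Y mu e | e in [set e : R | 0 < e < 1]].
Proof.
apply: cvg_lim => //.
have -> : [set e : R | 0 < e < 1] = [set` `]0, 1[].
  by apply/seteqP; split => e; rewrite /= in_itv.
by apply: nonincreasing_at_right_cvge => [|e e' _ _]; [rewrite bnd_simp | exact: Reps_homo].
Qed.

Lemma prefix_word_blocks (V : set (shspace a)) n x : V x -> prefix_word n x \in blocks V n.
Proof.
by move=> Vx; rewrite inE; apply/asboolP; exists x, 0; split => // i; rewrite ffunE add0r.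
Qed.

Lemma hammingE n (u v : word S n) : hamming u v = (\sum_i (u i != v i))%N.
Proof.
rewrite /hamming -sum1_card big_mkcond /=; apply: eq_bigr => i _.
have -> : (i \in in_set [set i0 | u i0 != v i0]) = (u i != v i).
  by rewrite unfold_in; apply/asboolP/idP.
by case: ifP.
Qed.

Lemma visits_diff n (z : Z) :
  visits R T2 (@diff_set S a) n z = (hamming (prefix_word n z.2) (prefix_word n z.1))%:R.
Proof.
rewrite /visits hammingE natr_sum; apply: eq_bigr => i _.
rewrite iter_sh_shift2 indicE !ffunE; congr (_ (nat_of_bool _)).
by apply/idP/idP; rewrite ?inE /diff_set /= !iter_sh_shift add0r eq_sym.
Qed.

End CoveringRadius.

(** * Upper and lower estimates of the covering radius *)

Section Estimates.
Context (R : realType) (S : finType) (a : S) (X Y : set (shspace a)).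
Context (mu : probability (shspace a) R).
Local Notation Z := (shspace a * shspace a)%type.
Local Notation T2 := (sh_shift2 a).
Hypothesis hX : constrained X.
Hypothesis hY : constrained Y.
Hypothesis muY : mu Y = 1%E.
Hypothesis mu_inv : sh_invariant (sh_shift a) mu.

Lemma Reps_words_le n r (e : R) :
  ((1 - e)%:E <= mu [set y | covered X Y r (@prefix_word S a n y)])%E ->
  (Reps_words mu (blocks X n) (blocks Y n) e <= (r%:R)%:E)%E.
Proof. by move=> h; apply: ereal_inf_lbound; exists r => //=; rewrite sum_covered. Qed.

(** Fix c above the disagreement mass. Off a set of [nu]-mass at most e, long prefixes of x and y
    differ in at most n c places, and the prefix of x is a block of X; projecting to y leaves
    [mu]-mass at least 1 - e covered. *)
Lemma R0_le_ergodic_joining nu : ergodic_joining X Y mu nu ->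
  (R0 X Y mu <= nu (diff0 X Y))%E.
Proof.
move=> [jnu enu]; rewrite (joining_diff0 hX hY jnu) R0E.
have [inu nuX nuY] := (joiningP hX hY muY nu).1 jnu.
have mX := constrained_measurable hX; have mY := constrained_measurable hY.
have [_ nuXY _] := jnu.
have mD := measurable_clopen2 (@clopen_diff S a).
have mT2 := @measurable_sh_shift2 S a.
apply: ge_ereal_sup => _ [e /andP[e0 e1] <-].
apply: lee_ltP => c dc.
have c0 : 0 < c by rewrite -lte_fin (le_lt_trans _ dc).
have [N hN] := ergodic_visits mT2 inu enu mD dc e0.
apply: limn_einf_le_frequently => M; exists (maxn M N).+1; first by rewrite leqW // leq_maxl.
set n := (maxn M N).+1.
have n0 : 0 < n%:R :> R by rewrite ltr0n.
rewrite lee_pdivrMl // -EFinM.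
apply: (@le_trans _ _ ((Num.truncn (n%:R * c))%:R)%:E); last first.
  by rewrite lee_fin truncn_le mulr_ge0 // ltW.
apply: Reps_words_le.
have {}hN : (nu [set z | (n%:R * c < visits R T2 (@diff_set S a) n z)%R] <= e%:E)%E.
  by apply: hN; rewrite leqW // leq_maxr.
set B := [set z | _] in hN.
have mB : measurable B by apply: measurable_set_lt => //; exact: measurable_visits.
have mC (r : nat) := measurable_fiber_pred (@measurable_prefix_word S a n) (covered X Y r (n := n)).
rewrite -nuY //.
(* Restricting to pairs in X and Y ensures that both prefixes are blocks. *)
apply: (@le_trans _ _ (nu (~` B `&` (X `*` Y)))).
  rewrite (probability_setI1 (measurableX mX mY) (measurableC mB) nuXY).
  by rewrite probability_setC // EFinB leeB.
apply: le_measure; rewrite ?inE.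
- by apply: measurableI; [exact: measurableC | exact: measurableX].
- exact: measurable_snd_pre.
move=> z [/negP nB [Xz Yz]] /=; rewrite /covered prefix_word_blocks //=.
apply/existsP; exists (prefix_word n z.1); rewrite prefix_word_blocks //=.
rewrite truncn_ge_nat; last by rewrite mulr_ge0 // ltW.
by rewrite -visits_diff leNgt.
Qed.

(** The tolerance 1 / (k + 2) lies strictly between 0 and 1 for every k, 0 included, and tends to 0;
    the small lower limit supplies a length beyond k. *)
Lemma covered_data (c : R) (k : nat) : (R0 X Y mu < c%:E)%E ->
  exists n r, [/\ (k < n)%N, r%:R <= n%:R * c &
    ((1 - k.+2%:R^-1)%:E <= mu [set y | covered X Y r (@prefix_word S a n y)])%E].
Proof.
move=> R0c; have : (Reps X Y mu k.+2%:R^-1 < c%:E)%E.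
  apply: le_lt_trans R0c; rewrite R0E; apply: ereal_sup_ubound.
  by exists (k.+2%:R^-1) => //=; rewrite invr_gt0 ltr0n /= invf_lt1 ?ltr0n // ltr1n.
move=> /limn_einf_lt_frequently/(_ k.+1)[n kn].
have n0 : 0 < n%:R :> R by rewrite ltr0n (leq_trans _ kn).
rewrite lte_pdivrMl // -EFinM => /ereal_inf_lt[_ [r /= hr <-]].
rewrite lte_fin => /ltW rn; exists n, r; split => //.
by rewrite -sum_covered.
Qed.

(** A block of X within distance r is moved to the origin by shift invariance of X; words that are
    not covered get the default point x0. *)
Lemma covered_lift n r : X !=set0 -> exists phi : word S n -> shspace a,
  forall w, X (phi w) /\
    (covered X Y r w -> (hamming w (prefix_word n (phi w)) <= r)%N).
Proof.
move=> [x0 Xx0]; suff /choice[phi hphi] : forall w : word S n, exists x, X x /\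
    (covered X Y r w -> (hamming w (prefix_word n x) <= r)%N) by exists phi.
move=> w; have [|_] := boolP (covered X Y r w); last by exists x0.
move=> /andP[_ /existsP[c /andP[]]]; rewrite inE => /asboolP[x [k [Xx xc]]] wc.
exists (fun i => x (i + k)); split; first exact: (constrained_shift hX k Xx).
move=> _; suff -> : @prefix_word S a n (fun i => x (i + k)) = c by [].
by apply/ffunP => i; rewrite ffunE -xc addrC.
Qed.

Definition lift_pair n (phi : word S n -> shspace a) (y : shspace a) : Z :=
  (phi (prefix_word n y), y).

Lemma clopen_lift_pair n (phi : word S n -> shspace a) C :
  clopen (@coord2 S a) C -> clopen (@coord1 S a) (lift_pair phi @^-1` C).
Proof.
move=> [N hN]; exists (maxn n N) => y y' yy'; apply: hN => i iN.
rewrite /coord2 /lift_pair /=.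
have -> : prefix_word n y' = prefix_word n y.
  apply/ffunP => j; rewrite !ffunE; apply/esym/yy'.
  by have := ltn_ord j; lia.
by congr pair; apply: yy'; rewrite leq_max iN orbT.
Qed.

(** The image of [mu] under [lift_pair] averaged over n shifts, given as a set function since only
    its values on clopen sets enter the limit. *)
Definition orbit_average n (phi : word S n -> shspace a) (C : set Z) : R :=
  n%:R^-1 * \sum_(i < n) fine (mu (lift_pair phi @^-1` (iter i T2 @^-1` C))).

Lemma clopen_iter2 i C : clopen (@coord2 S a) C -> clopen (@coord2 S a) (iter i T2 @^-1` C).
Proof.
elim: i C => [|i IH] C cC //=.
have -> : (fun x => T2 (iter i T2 x)) @^-1` C = iter i T2 @^-1` (T2 @^-1` C) by [].
by apply: IH; exact: clopen_shift2.
Qed.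

(** The difference telescopes to two terms in [0, 1], divided by n. *)
Lemma orbit_average_shift n (phi : word S n -> shspace a) C : clopen (@coord2 S a) C ->
  `|orbit_average phi (T2 @^-1` C) - orbit_average phi C| <= n%:R^-1.
Proof.
move=> cC; pose b i := fine (mu (lift_pair phi @^-1` (iter i T2 @^-1` C))).
have b01 i : 0 <= b i <= 1.
  rewrite /b fine_ge0 //=.
  have mI := measurable_clopen1 (clopen_lift_pair phi (clopen_iter2 i cC)).
  by rewrite -lee_fin fineK ?fin_num_measure // probability_le1.
have -> : orbit_average phi (T2 @^-1` C) = n%:R^-1 * \sum_(i < n) b i.+1.
  by congr (_ * _).
rewrite -mulrBr -sumrB -(big_mkord xpredT (fun i => b i.+1 - b i)) telescope_sumr //.
rewrite normrM ger0_norm ?invr_ge0 // ler_piMr ?invr_ge0 //.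
by have := b01 n; have := b01 0%N; rewrite ler_norml; lra.
Qed.

(** The left side is the expected Hamming distance between y and its lift over the first n
    coordinates: at most r on covered words, and at most n on the others, whose mass is at most
    e. *)
Lemma mean_hamming_le n r (phi : word S n -> shspace a) (e : R) :
  (forall w, covered X Y r w -> (hamming w (prefix_word n (phi w)) <= r)%N) ->
  ((1 - e)%:E <= mu [set y | covered X Y r (@prefix_word S a n y)])%E ->
  \sum_(i < n) fine (mu (lift_pair phi @^-1` (iter i T2 @^-1` (@diff_set S a)))) <= r%:R + n%:R * e.
Proof.
move=> hphi he; pose p (w : word S n) : R := fine (mu (@prefix_word S a n @^-1` [set w])).
have mw := @measurable_prefix_word S a n.
have sump (P : pred (word S n)) : fine (mu [set y | P (@prefix_word S a n y)]) = \sum_(w | P w) p w.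
  rewrite -(sum_fibers mu mw) -EFin_sum_fine //.
  by move=> w _; apply: fin_num_measure.
have p0 w : 0 <= p w by exact: fine_ge0.
have p1 : \sum_w p w = 1.
  have <- : fine (mu setT) = 1 by rewrite probability_setT.
  by rewrite -(sump xpredT); congr (fine (mu _)); apply/seteqP; split.
have -> : \sum_(i < n) fine (mu (lift_pair phi @^-1` (iter i T2 @^-1` (@diff_set S a)))) =
    \sum_w (hamming w (prefix_word n (phi w)))%:R * p w.
  under [RHS]eq_bigr => w _ do rewrite hammingE natr_sum mulr_suml.
  rewrite exchange_big /=; apply: eq_bigr => i _.
  transitivity (\sum_(w : word S n | w i != prefix_word n (phi w) i) p w).
    rewrite -(sump (fun w => w i != prefix_word n (phi w) i)); congr (fine (mu _)).
    apply/seteqP; split => y; rewrite /lift_pair /diff_set /= iter_sh_shift2 /=.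
      by rewrite !iter_sh_shift !ffunE add0r eq_sym.
    by rewrite !iter_sh_shift !ffunE add0r eq_sym.
  by rewrite big_mkcond; apply: eq_bigr => w _; case: eqP; rewrite ?mul0r ?mul1r.
rewrite (bigID (fun w => covered X Y r w)) /=; apply: lerD.
  apply: (@le_trans _ _ (\sum_(w | covered X Y r w) r%:R * p w)).
    by apply: ler_sum => w /hphi h; rewrite ler_wpM2r // ler_nat.
  rewrite -mulr_sumr ler_piMr // -p1 [leRHS](bigID (fun w => covered X Y r w)) /=.
  by rewrite lerDl sumr_ge0.
apply: (@le_trans _ _ (\sum_(w | ~~ covered X Y r w) n%:R * p w)).
  apply: ler_sum => w _; rewrite ler_wpM2r // ler_nat hammingE.
  by rewrite -[leqRHS]card_ord -sum1_card leq_sum // => i _; exact: leq_b1.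
rewrite -mulr_sumr ler_wpM2l //.
have : \sum_(w | covered X Y r w) p w + \sum_(w | ~~ covered X Y r w) p w = 1.
  by rewrite -p1 [RHS](bigID (fun w => covered X Y r w)).
move: he; have mC := measurable_fiber_pred mw (covered X Y r (n := n)).
rewrite -[mu _]fineK ?fin_num_measure // lee_fin sump; lra.
Qed.

Lemma joining_of_covering (c : R) : (R0 X Y mu < c%:E)%E ->
  exists nu, joining X Y mu nu /\ (nu (diff0 X Y) <= c%:E)%E.
Proof.
move=> R0c.
have [n hn] := boolp.choice (fun k => covered_data k R0c).
have {hn} [r hr] := boolp.choice hn.
(* The covered event for k = 0 has mass at least 1/2, so it contains a point and a block of X
   exists. *)
have X0 : X !=set0.
  have [_ _] := hr 0%N; set C := [set y | _] => h.
  have [y Cy] : C !=set0.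
    apply/set0P/eqP => C0; move: h; rewrite C0 measure0 lee_fin.
    by rewrite leNgt subr_gt0 invf_lt1 ?ltr0n // ltr1n.
  move: Cy; rewrite /C /= /covered => /andP[_ /existsP[w /andP[]]].
  by rewrite inE => /asboolP[x [k [Xx _]]]; exists x.
pose phi k := sval (cid (covered_lift (n k) (r k) X0)).
have hphi k := svalP (cid (covered_lift (n k) (r k) X0)); rewrite -/(phi _) /= in hphi.
have [U [UU Uoo]] := ultraFilterLemma eventually_filter.
have n0 k : 0 < (n k)%:R :> R.
  by have [kn _ _] := hr k; rewrite ltr0n (leq_trans _ kn).
have sum_cst k (x : R) : (n k)%:R^-1 * \sum_(i < n k) x = x.
  by rewrite sumr_const card_ord -[x *+ _]mulr_natl mulKf // gt_eqF.
have small e : 0 < e -> U [set k | k.+1%:R^-1 < e :> R].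
  by move=> e0; apply: Uoo; have := near_infty_natSinv_lt (PosNum e0).
have mL k i C : clopen (@coord2 S a) C -> measurable (lift_pair (phi k) @^-1` (iter i T2 @^-1` C)).
  by move=> cC; apply: measurable_clopen1; exact/clopen_lift_pair/clopen_iter2.
have [||||||nu [jnu hnu]] :=
  limit_joining hX hY muY UU (q := fun k => orbit_average (phi k)).
- by move=> k C cC; rewrite mulr_ge0 ?invr_ge0 // sumr_ge0 // => i _; exact: fine_ge0.
- move=> k; rewrite -[RHS](sum_cst k 1); congr (_ * _); apply: eq_bigr => i _.
  by rewrite !preimage_setT probability_setT.
- move=> k C C' cC cC' CC'; rewrite /orbit_average -mulrDr -big_split /=; congr (_ * _).
  apply: eq_bigr => i _; rewrite !preimage_setU measureU; [|exact: mL|exact: mL|].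
    by rewrite fineD // fin_num_measure //; exact: mL.
  apply/seteqP; split => // y [Cy C'y].
  by have : (C `&` C') (iter i T2 (lift_pair (phi k) y)) by []; rewrite CC'.
(* The invariance defect is at most 1 / n_k, and n_k exceeds k. *)
- move=> C cC; apply/cvgr0Pnorm_lt => e e0; apply: filterS (small e e0) => k /=.
  apply: le_lt_trans; apply: (le_trans (orbit_average_shift _ cC)).
  by have [kn _ _] := hr k; rewrite lef_pV2 ?posrE // ler_nat.
- move=> k m; rewrite -[RHS](sum_cst k 1); congr (_ * _); apply: eq_bigr => i _.
  rewrite (_ : _ @^-1` _ = setT) ?probability_setT //.
  apply/seteqP; split => // y _; rewrite /lift_pair /= iter_sh_shift2 /=.
  exists (iter i (sh_shift a) (phi k (prefix_word (n k) y))) => //.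
  by apply: (constrained_iter_shift hX); exact: (hphi k _).1.
- move=> k A cA; rewrite -[RHS](sum_cst k); congr (_ * _); apply: eq_bigr => i _.
  rewrite -(iter_invariant i (@measurable_sh_shift S a) mu_inv (measurable_clopen1 cA)).
  congr (fine (mu _)); apply/seteqP; split => y; rewrite /lift_pair /= iter_sh_shift2 //.
exists nu; split => //; rewrite (joining_diff0 hX hY jnu).
have cD := @clopen_diff S a.
rewrite -(fineK (fin_num_measure nu _ (measurable_clopen2 cD))) lee_fin.
apply/ler_addgt0Pr => e e0; apply: (cvgr_to_le (hnu _ cD)).
apply: filterS (small e e0) => k /= ke.
have [kn rn hk] := hr k.
(* After division by n_k, [mean_hamming_le] bounds the average by c + 1 / (k + 2), which is within e
   of c along U. *)
rewrite /orbit_average ler_pdivrMl //.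
apply: (le_trans (mean_hamming_le (fun w => (hphi k w).2) hk)).
rewrite mulrDr lerD // ler_pM2l //; apply: ltW; apply: le_lt_trans ke.
by rewrite lef_pV2 ?posrE // ler_nat.
Qed.

End Estimates.

Theorem theorem24 (R : realType) (S : finType) (a : S)
  (X Y : set (shspace a)) (mu : probability (shspace a) R) :
  constrained X -> constrained Y ->
  mu Y = 1%E -> sh_invariant (sh_shift a) mu -> sh_ergodic (sh_shift a) mu ->
  R0 X Y mu =
    ereal_inf [set nu (diff0 X Y) | nu in [set nu | ergodic_joining X Y mu nu]] /\
  ereal_inf [set nu (diff0 X Y) | nu in [set nu | ergodic_joining X Y mu nu]] =
    ereal_inf [set nu (diff0 X Y) | nu in [set nu | joining X Y mu nu]].
Proof.
move=> hX hY muY mu_inv mu_erg.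
set Ie := ereal_inf [set _ | _ in [set nu | ergodic_joining X Y mu nu]].
set Ij := ereal_inf [set _ | _ in [set nu | joining X Y mu nu]].
have R0Ie : (R0 X Y mu <= Ie)%E.
  by apply: le_ereal_inf_tmp => _ [nu enu <-]; exact: R0_le_ergodic_joining.
have IeIj : (Ie <= Ij)%E.
  apply: le_ereal_inf_tmp => _ [nu jnu <-].
  have [nu' [enu' hnu']] :=
    ergodic_joining_minimizer hX hY muY mu_inv mu_erg (ex_intro _ nu jnu).
  by apply: le_trans (hnu' _ jnu); apply: ereal_inf_lbound; exists nu'.
(* Testing only real c above the radius also covers an infinite radius, as when X is empty. *)
have IjR0 : (Ij <= R0 X Y mu)%E.
  apply: lee_ltP => c /(joining_of_covering hX hY muY mu_inv)[nu [jnu nuc]].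
  by apply: le_trans nuc; apply: ereal_inf_lbound; exists nu.
by split; apply/eqP; rewrite eq_le ?R0Ie ?IeIj ?(le_trans IeIj) ?(le_trans IjR0).
Qed.
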